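(* Let $X$ be a compact metric space, let $h \colon X \to X$ be a homeomorphism, let $Y \subset X$ be a nonempty compact subset with $Y \subset \overline{\bigcup_{n=1}^{\infty} h^n(Y)}$, and let $\mathcal{Y} = (m, T_0, \ldots, T_m, r_0, \ldots, r_m)$ be a Rokhlin system for $(X, h, Y)$. Let $R_l$, $D_l$, $\beta_l$, $\gamma_l$ be as defined in the context. Then $R_m$ has a recursive subhomogeneous decomposition with base spaces $T_0, T_1, \ldots, T_m$ and matrix sizes $r_0, r_1, \ldots, r_m$, given by $$R_m = \Big[ \cdots \big[ \big[ C(T_0, M_{r_0}) \oplus_{C(D_1, M_{r_1})} C(T_1, M_{r_1}) \big] \oplus_{C(D_2, M_{r_2})} C(T_2, M_{r_2}) \big] \oplus_{C(D_3, M_{r_3})} \cdots \Big] \oplus_{C(D_m, M_{r_m})} C(T_m, M_{r_m}),$$ in which, for $l = 0, 1, \ldots, m$, the $l$-th stage algebra is $R_l$, and, for $l = 1, \ldots, m$, the map $C(T_l, M_{r_l}) \to C(D_l, M_{r_l})$ is the restriction map $\rho_l$ and the map $R_{l-1} \to C(D_l, M_{r_l})$ is $\beta_l$. Moreover, $\gamma_m \colon C^*(\mathbb{Z}, X, h)_Y \to R_m$ is surjective, and is an isomorphism if $\bigcup_{n \in \mathbb{Z}} h^n(Y) = X$.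
   Context: Crossed product notation. $C^*(\mathbb{Z}, X, h)$ is the crossed product of $C(X)$ by $f \mapsto f \circ h^{-1}$, with standard unitary $u$ ($u f u^* = f \circ h^{-1}$) and standard conditional expectation $E$ onto $C(X)$. The formal series of $a$ is $\sum_{n} a_n u^n$ with $a_n = E(a u^{-n})$. For nonempty closed $Y \subset X$, identify $C_0(X \setminus Y)$ with the functions in $C(X)$ vanishing on $Y$; $C^*(\mathbb{Z}, X, h)_Y$ is the C*-subalgebra of $C^*(\mathbb{Z}, X, h)$ generated by $C(X)$ and $C_0(X \setminus Y) u$. Rows and columns of $N \times N$ matrices are indexed by $0, 1, \ldots, N-1$. If $Z \subset Y$ is nonempty closed and $N \in \mathbb{Z}_{>0}$ with $h^N(Z) \subset Y$, then $\gamma_{N, Z} \colon C^*(\mathbb{Z}, X, h)_Y \to C(Z, M_N)$ is the unital homomorphism with $\gamma_{N, Z}(a)(x)_{j,k} = a_{j-k}(h^j(x))$ for $x \in Z$ and $0 \leq j, k \leq N-1$. First return time. $r_Y(y) = \inf\{n \in \mathbb{Z}_{>0} \colon h^n(y) \in Y\} \in \mathbb{Z}_{>0} \cup \{\infty\}$ for $y \in Y$. Rokhlin system. For $Y \subset X$ nonempty compact with $Y \subset \overline{\bigcup_{n=1}^{\infty} h^n(Y)}$, a Rokhlin system for $(X, h, Y)$ is a tuple $(m, T_0, \ldots, T_m, r_0, \ldots, r_m)$ with $m \in \mathbb{Z}_{\geq 0}$, nonempty compact subsets $T_l \subset Y$, and $r_l \in \mathbb{Z}_{>0}$, such that, with $D_l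 = T_l \cap \bigcup_{j=0}^{l-1} T_j$ and $T_l^0 = T_l \setminus D_l$ (so $D_0 = \varnothing$): (1) $Y = \bigcup_{l=0}^m T_l$; (2) $r_0 \leq r_1 \leq \cdots \leq r_m$; (3) $h^{r_l}(T_l) \subset Y$ for all $l$; (4) $r_Y(y) = r_l$ for all $l$ and $y \in T_l^0$; (5) for every $l$, either $T_l = \varnothing$ and $r_l \in \{r_Y(y) \colon y \in Y\}$, or there exists $y \in T_l$ with $r_Y(y) = r_l$. Maps $\gamma_l$. For $0 \leq l \leq m$, $\gamma_l \colon C^*(\mathbb{Z}, X, h)_Y \to \bigoplus_{j=0}^{l} C(T_j, M_{r_j})$ is $\gamma_l(a) = (\gamma_{r_0, T_0}(a), \ldots, \gamma_{r_l, T_l}(a))$. Admissible sequences and $\beta_{l,\mu}$. $\mathcal{S}_l$ is the set of all finite sequences $\mu = (\mu(1), \ldots, \mu(t))$ in $\{0, 1, \ldots, l-1\}$ with $\sum_{s=1}^t r_{\mu(s)} = r_l$; $t$ is the length of $\mu$. For $\mu \in \mathcal{S}_l$, $T_{l,\mu} = \{x \in T_l \colon h^{r_{\mu(1)} + \cdots + r_{\mu(s-1)}}(x) \in T_{\mu(s)} \text{ for } s = 1, \ldots, t\}$ (for $s = 1$ the exponent is $0$), and $\beta_{l,\mu} \colon \bigoplus_{i=0}^{l-1} C(T_i, M_{r_i}) \to C(T_{l,\mu}, M_{r_l})$ sends $(b_0, \ldots, b_{l-1})$ to the function whose value at $x$ is the block diagonal matrix with successive blocks $b_{\mu(s)}\big(h^{r_{\mu(1)}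 + \cdots + r_{\mu(s-1)}}(x)\big)$, $s = 1, \ldots, t$. Algebras $R_l$. $R_0 = C(T_0, M_{r_0})$, and for $1 \leq l \leq m$, $R_l$ is the set of $(b_0, \ldots, b_l) \in R_{l-1} \oplus C(T_l, M_{r_l}) \subset \bigoplus_{i=0}^{l} C(T_i, M_{r_i})$ with $b_l(x) = \beta_{l,\mu}(b_0, \ldots, b_{l-1})(x)$ for all $\mu \in \mathcal{S}_l$ and $x \in T_{l,\mu}$. Maps $\beta_l$. For $1 \leq l \leq m$, $\beta_l \colon R_{l-1} \to C(D_l, M_{r_l})$ is the unique unital homomorphism with $\beta_l(b)(x) = \beta_{l,\mu}(b)(x)$ for all $b \in R_{l-1}$, $\mu \in \mathcal{S}_l$, $x \in T_{l,\mu}$ (one has $D_l = \bigcup_{\mu \in \mathcal{S}_l} T_{l,\mu}$, and $\beta_l$ is well defined). The map $\rho_l \colon C(T_l, M_{r_l}) \to C(D_l, M_{r_l})$ is restriction. Recursive subhomogeneous decomposition. An iterated pullback $[\cdots[[C_0 \oplus_{C_1^{(0)}} C_1] \oplus_{C_2^{(0)}} C_2] \cdots] \oplus_{C_m^{(0)}} C_m$ where $C_l = C(T_l, M_{r_l})$ with $T_l$ compact Hausdorff, $C_l^{(0)} = C(T_l^{(0)}, M_{r_l})$ with $T_l^{(0)} \subset T_l$ closed (possibly empty), the maps $C_l \to C_l^{(0)}$ are restriction maps, and the maps from the $(l-1)$-st stage algebra (the pullback formed from $C_0, \ldots, C_{l-1}$) to $C_l^{(0)}$ are arbitrary unital homomorphisms.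 A pullback is $A \oplus_{C} B = \{(a, f) \in A \oplus B \colon \varphi(a) = \rho(f)\}$ for given $\varphi \colon A \to C$ and $\rho \colon B \to C$. Here $R_l$ is identified with the pullback of $R_{l-1}$ and $C(T_l, M_{r_l})$ via $(b_0, \ldots, b_l) \mapsto ((b_0, \ldots, b_{l-1}), b_l)$. The $T_l$ are the base spaces and the $r_l$ the matrix sizes. *)

(* Defs.v *)
From HB Require Import structures.
From mathcomp Require Import all_boot all_order all_algebra.
From mathcomp Require Import all_classical all_reals all_analysis.

Set Implicit Arguments.
Unset Strict Implicit.
Unset Printing Implicit Defensive.

Import Order.TTheory GRing.Theory Num.Theory.
Import numFieldNormedType.Exports.

Local Open Scope classical_set_scope.
Local Open Scope ring_scope.

(** The scalar field [C : numClosedFieldType] is meant to be the field of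
    complex numbers, that is [R[i]] with [R : realType]. *)

(** * Unital star-algebras and C*-algebras

    MathComp's [algType] excludes the zero ring, but the zero algebra is needed
    here as [C(D, M_N)] with [D] empty; moreover Hierarchy-Builder accepts no
    common extension of [normedModType] and the ring structures other than
    number fields.  Star-algebras are therefore built over [lmodType] and carry
    their own unit [aone] and product [a ** b]. *)

Reserved Notation "a ** b" (at level 40, left associativity).

HB.mixin Record isStarAlgebra (C : numClosedFieldType) A
    & GRing.Lmodule C A := {
  aone : A;
  amul : A -> A -> A;
  amulA : forall a b c : A, amul a (amul b c) = amul (amul a b) c;
  amul1l : forall a : A, amul aone a = a;
  amul1r : forall a : A, amul a aone = a;
  amulDl : forall a b c : A, amul (a + b) c = amul a c + amul b c;
  amulDr : forall a b c : A, amul a (b + c) = amul a b + amul a c;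
  amulZl : forall (k : C) (a b : A), amul (k *: a) b = k *: amul a b;
  amulZr : forall (k : C) (a b : A), amul a (k *: b) = k *: amul a b;
  star : A -> A;
  starK : forall a : A, star (star a) = a;
  starD : forall a b : A, star (a + b) = star a + star b;
  starZ : forall (k : C) (a : A), star (k *: a) = k^* *: star a;
  starM : forall a b : A, star (amul a b) = amul (star b) (star a)
}.

#[short(type="starAlgType")]
HB.structure Definition StarAlgebra (C : numClosedFieldType) :=
  {A of GRing.Lmodule C A & isStarAlgebra C A}.

Notation "a ** b" := (amul a b) : ring_scope.

Definition apow (C : numClosedFieldType) (A : starAlgType C) (a : A) (n : nat) :
    A :=
  iter n (amul a) aone.

HB.mixin Record isCStarAlgebra (C : numClosedFieldType) A
    & StarAlgebra C A & NormedModule C A := {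
  cstar_normM : forall a b : A, `|a ** b| <= `|a| * `|b|;
  cstar_norm : forall a : A, `|star a ** a| = `|a| ^+ 2
}.

#[short(type="cstarAlgType")]
HB.structure Definition CStarAlgebra (C : numClosedFieldType) :=
  {A of StarAlgebra C A & CompleteNormedModule C A & isCStarAlgebra C A}.

(** ** Instances *)

Section StarScalar.
Variable C : numClosedFieldType.
Implicit Types (k : C) (a b c : C^o).
Definition scalar_one : C^o := (1 : C).
Definition scalar_mul a b : C^o := (a : C) * (b : C).
Definition scalar_star a : C^o := Num.conj (a : C).
Fact scalar_mulA a b c :
  scalar_mul a (scalar_mul b c) = scalar_mul (scalar_mul a b) c.
Proof. exact: mulrA. Qed.
Fact scalar_mul1l a : scalar_mul scalar_one a = a.
Proof. exact: mul1r. Qed.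
Fact scalar_mul1r a : scalar_mul a scalar_one = a.
Proof. exact: mulr1. Qed.
Fact scalar_mulDl a b c :
  scalar_mul (a + b) c = scalar_mul a c + scalar_mul b c.
Proof. exact: mulrDl. Qed.
Fact scalar_mulDr a b c :
  scalar_mul a (b + c) = scalar_mul a b + scalar_mul a c.
Proof. exact: mulrDr. Qed.
Fact scalar_mulZl k a b : scalar_mul (k *: a) b = k *: scalar_mul a b.
Proof. exact/esym/mulrA. Qed.
Fact scalar_mulZr k a b : scalar_mul a (k *: b) = k *: scalar_mul a b.
Proof. exact: mulrCA. Qed.
Fact scalar_starK a : scalar_star (scalar_star a) = a.
Proof. exact: conjCK. Qed.
Fact scalar_starD a b : scalar_star (a + b) = scalar_star a + scalar_star b.
Proof. exact: rmorphD. Qed.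
Fact scalar_starZ k a : scalar_star (k *: a) = k^* *: scalar_star a.
Proof. exact: rmorphM. Qed.
Fact scalar_starM a b :
  scalar_star (scalar_mul a b) = scalar_mul (scalar_star b) (scalar_star a).
Proof. by rewrite /scalar_star /scalar_mul rmorphM mulrC. Qed.
HB.instance Definition _ := isStarAlgebra.Build C C^o
  scalar_mulA scalar_mul1l scalar_mul1r scalar_mulDl scalar_mulDr
  scalar_mulZl scalar_mulZr
  scalar_starK scalar_starD scalar_starZ scalar_starM.
End StarScalar.

Section StarMatrix.
Variables (C : numClosedFieldType) (N : nat).
Implicit Types (k : C) (a b : 'M[C]_N).
Definition conj_trmx a : 'M[C]_N := map_mx Num.conj a^T.
Fact mx_mulZl k a b : (k *: a) *m b = k *: (a *m b).
Proof. by rewrite scalemxAl. Qed.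
Fact mx_mulZr k a b : a *m (k *: b) = k *: (a *m b).
Proof. by rewrite scalemxAr. Qed.
Fact mx_starK a : conj_trmx (conj_trmx a) = a.
Proof. by apply/matrixP => i j; rewrite !mxE conjCK. Qed.
Fact mx_starD a b : conj_trmx (a + b) = conj_trmx a + conj_trmx b.
Proof. by apply/matrixP => i j; rewrite !mxE rmorphD. Qed.
Fact mx_starZ k a : conj_trmx (k *: a) = k^* *: conj_trmx a.
Proof. by apply/matrixP => i j; rewrite !mxE rmorphM. Qed.
Fact mx_starM a b : conj_trmx (a *m b) = conj_trmx b *m conj_trmx a.
Proof. by rewrite /conj_trmx trmx_mul map_mxM. Qed.
HB.instance Definition _ := isStarAlgebra.Build C 'M[C]_N
  (@mulmxA C N N N N) (@mul1mx C N N) (@mulmx1 C N N)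
  (@mulmxDl C N N N) (@mulmxDr C N N N)
  mx_mulZl mx_mulZr mx_starK mx_starD mx_starZ mx_starM.
End StarMatrix.

Section StarPair.
Variables (C : numClosedFieldType) (A B : starAlgType C).
Implicit Types (k : C) (p q s : A * B).
Definition pair_one : A * B := (aone, aone).
Definition pair_mul p q : A * B := (p.1 ** q.1, p.2 ** q.2).
Definition pair_star p : A * B := (star p.1, star p.2).
Fact pair_mulA p q s : pair_mul p (pair_mul q s) = pair_mul (pair_mul p q) s.
Proof. by congr pair; exact: amulA. Qed.
Fact pair_mul1l p : pair_mul pair_one p = p.
Proof. by case: p => a b; congr pair; exact: amul1l. Qed.
Fact pair_mul1r p : pair_mul p pair_one = p.
Proof. by case: p => a b; congr pair; exact: amul1r. Qed.
Fact pair_mulDl p q s : pair_mul (p + q) s = pair_mul p s + pair_mul q s.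
Proof. by congr pair; exact: amulDl. Qed.
Fact pair_mulDr p q s : pair_mul p (q + s) = pair_mul p q + pair_mul p s.
Proof. by congr pair; exact: amulDr. Qed.
Fact pair_mulZl k p q : pair_mul (k *: p) q = k *: pair_mul p q.
Proof. by congr pair; exact: amulZl. Qed.
Fact pair_mulZr k p q : pair_mul p (k *: q) = k *: pair_mul p q.
Proof. by congr pair; exact: amulZr. Qed.
Fact pair_starK p : pair_star (pair_star p) = p.
Proof. by case: p => a b; congr pair; exact: starK. Qed.
Fact pair_starD p q : pair_star (p + q) = pair_star p + pair_star q.
Proof. by congr pair; exact: starD. Qed.
Fact pair_starZ k p : pair_star (k *: p) = k^* *: pair_star p.
Proof. by congr pair; exact: starZ. Qed.
Fact pair_starM p q : pair_star (pair_mul p q) = pair_mul (pair_star q) (pair_star p).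
Proof. by congr pair; exact: starM. Qed.
HB.instance Definition _ := isStarAlgebra.Build C (A * B)%type
  pair_mulA pair_mul1l pair_mul1r pair_mulDl pair_mulDr pair_mulZl pair_mulZr
  pair_starK pair_starD pair_starZ pair_starM.
End StarPair.

Section StarFun.
Variables (C : numClosedFieldType) (T : Type) (A : starAlgType C).
Implicit Types (k : C) (f g e : T -> A).
Definition fct_one : T -> A := fun=> aone.
Definition fct_mul f g : T -> A := fun x => f x ** g x.
Definition fct_star f : T -> A := fun x => star (f x).
Fact fct_mulA f g e : fct_mul f (fct_mul g e) = fct_mul (fct_mul f g) e.
Proof. by apply/funext => x; exact: amulA. Qed.
Fact fct_mul1l f : fct_mul fct_one f = f.
Proof. by apply/funext => x; exact: amul1l. Qed.
Fact fct_mul1r f : fct_mul f fct_one = f.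
Proof. by apply/funext => x; exact: amul1r. Qed.
Fact fct_mulDl f g e : fct_mul (f + g) e = fct_mul f e + fct_mul g e.
Proof. by apply/funext => x; exact: amulDl. Qed.
Fact fct_mulDr f g e : fct_mul f (g + e) = fct_mul f g + fct_mul f e.
Proof. by apply/funext => x; exact: amulDr. Qed.
Fact fct_mulZl k f g : fct_mul (k *: f) g = k *: fct_mul f g.
Proof. by apply/funext => x; exact: amulZl. Qed.
Fact fct_mulZr k f g : fct_mul f (k *: g) = k *: fct_mul f g.
Proof. by apply/funext => x; exact: amulZr. Qed.
Fact fct_starK f : fct_star (fct_star f) = f.
Proof. by apply/funext => x; exact: starK. Qed.
Fact fct_starD f g : fct_star (f + g) = fct_star f + fct_star g.
Proof. by apply/funext => x; exact: starD. Qed.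
Fact fct_starZ k f : fct_star (k *: f) = k^* *: fct_star f.
Proof. by apply/funext => x; exact: starZ. Qed.
Fact fct_starM f g : fct_star (fct_mul f g) = fct_mul (fct_star g) (fct_star f).
Proof. by apply/funext => x; exact: starM. Qed.
HB.instance Definition _ := isStarAlgebra.Build C (T -> A)
  fct_mulA fct_mul1l fct_mul1r fct_mulDl fct_mulDr fct_mulZl fct_mulZr
  fct_starK fct_starD fct_starZ fct_starM.
End StarFun.

Section DProd.
Variables (C : numClosedFieldType) (I : Type) (A : I -> starAlgType C).

Definition dprod : Type := forall i : I, A i.

Implicit Types (k : C) (b c d : dprod).
Let dext b c : (forall i, b i = c i) -> b = c.
Proof. exact: functional_extensionality_dep. Qed.

HB.instance Definition _ := gen_eqMixin dprod.
HB.instance Definition _ := gen_choiceMixin dprod.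

Definition dprod_zero : dprod := fun i => 0.
Definition dprod_opp b : dprod := fun i => - b i.
Definition dprod_add b c : dprod := fun i => b i + c i.
Fact dprod_addA : associative dprod_add.
Proof. by move=> b c d; apply: dext => i; exact: addrA. Qed.
Fact dprod_addC : commutative dprod_add.
Proof. by move=> b c; apply: dext => i; exact: addrC. Qed.
Fact dprod_add0 : left_id dprod_zero dprod_add.
Proof. by move=> b; apply: dext => i; exact: add0r. Qed.
Fact dprod_addN : left_inverse dprod_zero dprod_opp dprod_add.
Proof. by move=> b; apply: dext => i; exact: addNr. Qed.
HB.instance Definition _ :=
  GRing.isZmodule.Build dprod dprod_addA dprod_addC dprod_add0 dprod_addN.

Definition dprod_scale k b : dprod := fun i => k *: b i.
Fact dprod_scaleA j k b :
  dprod_scale j (dprod_scale k b) = dprod_scale (j * k) b.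
Proof. by apply: dext => i; exact: scalerA. Qed.
Fact dprod_scale1 : left_id 1 dprod_scale.
Proof. by move=> b; apply: dext => i; exact: scale1r. Qed.
Fact dprod_scaleDr : right_distributive dprod_scale +%R.
Proof. by move=> k b c; apply: dext => i; exact: scalerDr. Qed.
Fact dprod_scaleDl b : {morph dprod_scale^~ b : j k / j + k}.
Proof. by move=> j k; apply: dext => i; exact: scalerDl. Qed.
HB.instance Definition _ := GRing.Zmodule_isLmodule.Build C dprod
  dprod_scaleA dprod_scale1 dprod_scaleDr dprod_scaleDl.

Definition dprod_one : dprod := fun i => aone.
Definition dprod_mul b c : dprod := fun i => b i ** c i.
Definition dprod_star b : dprod := fun i => star (b i).
Fact dprod_mulA b c d :
  dprod_mul b (dprod_mul c d) = dprod_mul (dprod_mul b c) d.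
Proof. by apply: dext => i; exact: amulA. Qed.
Fact dprod_mul1l b : dprod_mul dprod_one b = b.
Proof. by apply: dext => i; exact: amul1l. Qed.
Fact dprod_mul1r b : dprod_mul b dprod_one = b.
Proof. by apply: dext => i; exact: amul1r. Qed.
Fact dprod_mulDl b c d : dprod_mul (b + c) d = dprod_mul b d + dprod_mul c d.
Proof. by apply: dext => i; exact: amulDl. Qed.
Fact dprod_mulDr b c d : dprod_mul b (c + d) = dprod_mul b c + dprod_mul b d.
Proof. by apply: dext => i; exact: amulDr. Qed.
Fact dprod_mulZl k b c : dprod_mul (k *: b) c = k *: dprod_mul b c.
Proof. by apply: dext => i; exact: amulZl. Qed.
Fact dprod_mulZr k b c : dprod_mul b (k *: c) = k *: dprod_mul b c.
Proof. by apply: dext => i; exact: amulZr. Qed.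
Fact dprod_starK b : dprod_star (dprod_star b) = b.
Proof. by apply: dext => i; exact: starK. Qed.
Fact dprod_starD b c : dprod_star (b + c) = dprod_star b + dprod_star c.
Proof. by apply: dext => i; exact: starD. Qed.
Fact dprod_starZ k b : dprod_star (k *: b) = k^* *: dprod_star b.
Proof. by apply: dext => i; exact: starZ. Qed.
Fact dprod_starM b c :
  dprod_star (dprod_mul b c) = dprod_mul (dprod_star c) (dprod_star b).
Proof. by apply: dext => i; exact: starM. Qed.
HB.instance Definition _ := isStarAlgebra.Build C dprod
  dprod_mulA dprod_mul1l dprod_mul1r dprod_mulDl dprod_mulDr
  dprod_mulZl dprod_mulZr dprod_starK dprod_starD dprod_starZ dprod_starM.
End DProd.

(** * Subalgebras and homomorphisms

    The algebras [C(X)], [C(T, M_N)], [R_l], [C^*(Z, X, h)_Y] are represented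
    as subsets of ambient star-algebras with the same operations and unit.  A
    homomorphism between two of them is a function on the ambient types, whose
    values outside its domain [P] are irrelevant. *)

Section Homs.
Variables (C : numClosedFieldType) (A B : starAlgType C).

Record star_hom (P : set A) (Q : set B) (f : A -> B) : Prop := {
  star_hom_sub : forall a, P a -> Q (f a);
  star_hom1 : f aone = aone;
  star_homD : forall a b, P a -> P b -> f (a + b) = f a + f b;
  star_homZ : forall (k : C) a, P a -> f (k *: a) = k *: f a;
  star_homM : forall a b, P a -> P b -> f (a ** b) = f a ** f b;
  star_hom_star : forall a, P a -> f (star a) = star (f a)
}.

Definition star_iso (P : set A) (Q : set B) (f : A -> B) : Prop :=
  star_hom P Q f /\ set_bij P Q f.

End Homs.

Definition pullback (A B D : Type) (P : set A) (Q : set B)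
    (phi : A -> D) (rho : B -> D) : set (A * B) :=
  [set ab | [/\ P ab.1, Q ab.2 & phi ab.1 = rho ab.2]].

Record cstar_subalgebra (C : numClosedFieldType) (A : cstarAlgType C)
    (S : set A) : Prop := {
  csub_closed : closed S;
  csub0 : S 0;
  csubD : forall a b, S a -> S b -> S (a + b);
  csubZ : forall (k : C) a, S a -> S (k *: a);
  csubM : forall a b, S a -> S b -> S (a ** b);
  csub_star : forall a, S a -> S (star a)
}.

Definition cstar_generated (C : numClosedFieldType) (A : cstarAlgType C)
    (G : set A) : set A :=
  smallest (@cstar_subalgebra C A) G.

(** The carrier of [C(X)]; [C^o] is [C] as a module over itself. *)
Definition contfun (C : numClosedFieldType) (X : topologicalType) :
    set (X -> C^o) :=
  [set f | continuous f].

Arguments contfun : clear implicits.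

(** The carrier of [C(T, M_N)]. *)
Definition contmx (C : numClosedFieldType) (T : topologicalType) (N : nat) :
    set (T -> 'M[C]_N) :=
  [set f | continuous f].
Arguments contmx : clear implicits.

(** * The crossed product *)

Section CrossedProduct.
Variables (C : numClosedFieldType) (X : topologicalType) (hinv : X -> X).

Record covariant (B : cstarAlgType C) (phi : (X -> C^o) -> B) (v : B) :
    Prop := {
  cov_hom : star_hom (contfun C X) [set: B] phi;
  cov_unitary : star v ** v = aone /\ v ** star v = aone;
  cov_conj : forall f, contfun C X f -> v ** phi f ** star v = phi (f \o hinv)
}.

(** [A], with [iota : C(X) -> A] and [u], is the C*-algebra generated by a
    universal covariant pair.  Homomorphisms of C*-algebras are automatically
    contractive, so the bound on [psi] does not restrict it; uniqueness of
    [psi] follows from generation. *)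
Record crossed_product (A : cstarAlgType C) (iota : (X -> C^o) -> A) (u : A) :
    Prop := {
  cp_covariant : covariant iota u;
  cp_generated : cstar_generated (iota @` contfun C X `|` [set u]) = setT;
  cp_universal : forall (B : cstarAlgType C) (phi : (X -> C^o) -> B) (v : B),
    covariant phi v ->
    exists psi : A -> B, [/\ star_hom setT setT psi,
      forall a, `|psi a| <= `|a|,
      forall f, contfun C X f -> psi (iota f) = phi f & psi u = v]
}.

Variables (A : cstarAlgType C) (iota : (X -> C^o) -> A) (u : A).

(** Integer powers of the unitary [u], whose inverse is [star u]. *)
Definition upow (n : int) : A :=
  match n with Posz k => apow u k | Negz k => apow (star u) k.+1 end.

Record standard_expectation (E : A -> X -> C^o) : Prop := {
  sexp_cont : forall a, contfun C X (E a);
  sexpD : forall a b, E (a + b) = E a + E b;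
  sexpZ : forall (k : C) a, E (k *: a) = k *: E a;
  sexp_contractive : forall a x, `|E a x| <= `|a|;
  sexp_mono : forall f (n : int), contfun C X f ->
    E (iota f ** upow n) = if n == 0 then f else 0
}.

Definition coef (E : A -> X -> C^o) (a : A) (n : int) : X -> C^o :=
  E (a ** upow (- n)).

(** [C^*(Z, X, h)_Y] *)
Definition orbit_breaking (Y : set X) : set A :=
  cstar_generated (iota @` contfun C X `|`
    (fun f => iota f ** u) @`
      [set f | contfun C X f /\ forall y, Y y -> f y = 0]).

End CrossedProduct.

(** * Recursive subhomogeneous decompositions *)

Section RSH.
Variable C : numClosedFieldType.

(** The ambient algebra of [C(T_0, M_(r 0)) + ... + C(T_(n-1), M_(r (n-1)))]. *)
Definition dsum (T : nat -> Type) (r : nat -> nat) (n : nat) : Type :=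
  dprod (fun i : 'I_n => (T i -> 'M[C]_(r i)) : starAlgType C).

HB.instance Definition _ T r n := StarAlgebra.on (dsum T r n).

Definition dsum_init (T : nat -> Type) r n (b : dsum T r n.+1) : dsum T r n :=
  fun i => b (widen_ord (leqnSn n) i).

Definition dsum_split (T : nat -> Type) r n (b : dsum T r n.+1) :
    dsum T r n * (T n -> 'M[C]_(r n)) :=
  (dsum_init b, b ord_max).

(** [S l] is the [l]-th stage algebra, inside the sum of the first [l + 1]
    algebras [C(T_i, M_(r i))]; [phi l] is the map from the [l]-th stage to
    [C(T0_(l+1), M_(r (l+1)))].  Only indices up to [m] matter. *)
Record rsh_decomposition (m : nat) (T : nat -> topologicalType)
    (T0 : forall l, set (T l)) (r : nat -> nat)
    (S : forall l, set (dsum T r l.+1))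
    (phi : forall l, dsum T r l.+1 -> T0 l.+1 -> 'M[C]_(r l.+1)) : Prop := {
  rsh_base : forall l, (l <= m)%N ->
    compact [set: T l] /\ hausdorff_space (T l);
  rsh_size : forall l, (l <= m)%N -> (0 < r l)%N;
  rsh_closed : forall l, (l < m)%N -> closed (T0 l.+1);
  rsh_zero : star_iso (S 0%N) (contmx C (T 0%N) (r 0%N)) (fun b => b ord0);
  rsh_hom : forall l, (l < m)%N ->
    star_hom (S l) (contmx C (T0 l.+1) (r l.+1)) (phi l);
  rsh_pullback : forall l, (l < m)%N ->
    star_iso (S l.+1)
      (pullback (S l) (contmx C (T l.+1) (r l.+1))
         (phi l) (fun f => f \o set_val))
      (@dsum_split T r l.+1)
}.

End RSH.

(** * Rokhlin systems *)

Section Rokhlin.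
Variables (X : topologicalType) (h : X -> X).

(** The first return time, [None] standing for infinity. *)
Definition first_return (Y : set X) (y : X) : option nat :=
  match pselect (exists n, (0 < n)%N && `[< Y (iter n h y) >]) with
  | left e => Some (ex_minn e)
  | right _ => None
  end.

Variables (Y : set X) (m : nat) (T : nat -> set X) (r : nat -> nat).

Definition Tprev (l : nat) : set X := \bigcup_(j in [set j | (j < l)%N]) T j.

Record rokhlin_system : Prop := {
  rok_nonempty : forall l, (l <= m)%N -> T l !=set0;
  rok_compact : forall l, (l <= m)%N -> compact (T l);
  rok_sub : forall l, (l <= m)%N -> T l `<=` Y;
  rok_pos : forall l, (l <= m)%N -> (0 < r l)%N;
  rok_cover : Y = \bigcup_(l in [set l | (l <= m)%N]) T l;
  rok_mono : forall l, (l < m)%N -> (r l <= r l.+1)%N;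
  rok_into : forall l, (l <= m)%N -> iter (r l) h @` T l `<=` Y;
  rok_return : forall l, (l <= m)%N ->
    forall y, (T l `\` (T l `&` Tprev l)) y -> first_return Y y = Some (r l);
  rok_attained : forall l, (l <= m)%N ->
    (T l = set0 /\ exists2 y, Y y & first_return Y y = Some (r l)) \/
    exists2 y, T l y & first_return Y y = Some (r l)
}.

(** [D_l], as a subset of the space [T_l]. *)
Definition Dset (l : nat) : set (T l) := set_val @^-1` (T l `&` Tprev l).
Arguments Dset : clear implicits.

(** [mu : seq 'I_l] lists the 0-based values [mu(1), ..., mu(t)]. *)
Definition admissible (l : nat) : set (seq 'I_l) :=
  [set mu : seq 'I_l | (\sum_(i <- mu) r i)%N = r l].

Definition offset (l : nat) (mu : seq 'I_l) (s : nat) : nat :=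
  (\sum_(i <- take s mu) r i)%N.

Definition Tmu (l : nat) (mu : seq 'I_l) : set (T l) :=
  [set x | forall s : 'I_(size mu),
    T (tnth (in_tuple mu) s) (iter (offset mu s) h (set_val x))].

Variable C : numClosedFieldType.

Let base (l : nat) : Type := T l.

(** The value of [f : T -> M_N] at a point of [X]; only used on [T]. *)
Definition eval_at (S : set X) (N : nat) (f : S -> 'M[C]_N) (x : X) :
    'M[C]_N :=
  oapp f 0 (insub x).

(** [beta_(l, mu)].  For admissible [mu] the sizes of the blocks add up to
    [r l], so that [conform_mx] is a mere cast. *)
Definition beta_mu (l : nat) (mu : seq 'I_l) (b : dsum C base r l)
    (x : Tmu mu) : 'M[C]_(r l) :=
  conform_mx 0
    (@mxdiag C (size mu) (fun s => r (tnth (in_tuple mu) s))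
       (fun s => eval_at (b (tnth (in_tuple mu) s))
                   (iter (offset mu s) h (set_val (set_val x))))).

Fixpoint Ralg (l : nat) : set (dsum C base r l.+1) :=
  match l return set (dsum C base r l.+1) with
  | 0 => [set b : dsum C base r 1 | contmx C (T 0%N) (r 0%N) (b ord0)]
  | k.+1 => [set b : dsum C base r k.+2 | [/\ Ralg (dsum_init b),
      contmx C (T k.+1) (r k.+1) (b ord_max) &
      forall mu : seq 'I_k.+1, admissible mu -> forall x : Tmu mu,
        b ord_max (set_val x) = beta_mu (dsum_init b) x]]
  end.

(** [beta_(l+1) : R_l -> C(D_(l+1), M_(r (l+1)))] is a unital homomorphism
    which agrees with all the [beta_(l+1, mu)]. *)
Definition beta_spec (l : nat)
    (beta : dsum C base r l.+1 -> Dset l.+1 -> 'M[C]_(r l.+1)) : Prop :=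
  star_hom (@Ralg l) (contmx C (Dset l.+1) (r l.+1)) beta /\
  forall b, Ralg b -> forall mu : seq 'I_l.+1, admissible mu ->
    forall (x : Tmu mu) (y : Dset l.+1), set_val y = set_val x ->
      beta b y = beta_mu b x.

Definition is_beta (l : nat)
    (beta : dsum C base r l.+1 -> Dset l.+1 -> 'M[C]_(r l.+1)) : Prop :=
  beta_spec beta /\
  forall beta', beta_spec beta' -> forall b, Ralg b -> beta' b = beta b.

(** [gamma_l], for the Fourier coefficients [coef] of an element of the
    crossed product. *)
Definition gamma (A : cstarAlgType C) (u : A) (E : A -> X -> C^o) (l : nat)
    (a : A) : dsum C base r l.+1 :=
  fun i x => \matrix_(j, k)
    coef u E a (j%:Z - k%:Z) (iter j h (set_val x)).

End Rokhlin.

Arguments Dset {X} T l _.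
Arguments Ralg {X} h T r C l _.
Arguments gamma {X} h T r {C A} u E l a.

(** Integer iterates of a homeomorphism [h] with inverse [hinv]. *)
Definition ziter (X : Type) (h hinv : X -> X) (n : int) : X -> X :=
  match n with Posz k => iter k h | Negz k => iter k.+1 hinv end.

(* Main.v *)
Require Import Defs.
From mathcomp Require Import all_boot all_order all_algebra.
From mathcomp Require Import complex.
From mathcomp Require Import all_classical all_reals all_analysis.
From mathcomp Require Import ring zify.

(** Everything is read off from one family of matrices.  For [a] in the crossed
    product and a point [y], put [a_(j,k) := a_(j-k) (h^j y)] for integers [j]
    and [k]; this is [orbmx a y j k], the matrix of [a] along the orbit of [y],
    and [gamma_l] collects its windows [0 <= j, k < r_i] at the points of [T_i].

    A generator [f] acts on these matrices by a diagonal matrix and [f u] by a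
    weighted shift, whose weight at [y] vanishes if [y] is in [Y] and [f] is
    zero on [Y].  So for [a] in [C^*(Z, X, h)_Y] the matrix is block diagonal,
    cut at each visit of the orbit to [Y] ([orbmx_block]), and compression to a
    window between two visits is multiplicative ([window_multiplicative]).  Hence
    [gamma_l] is a homomorphism ([gamma_hom]) with values in [R_l], the relations
    of [R_l] being exactly the cuts at the visits ([gamma_Ralg]).

    Conversely let [b] be in [R_l].  Following an orbit through its successive
    returns to [Y], the relations express every entry of [b] through the entries
    over points with the right first return time ([Ralg_canonical]); therefore
    entries which are to become the same value [a_n (x)] agree
    ([Ralg_consistent]).  As the sets on which [a_n] is prescribed are finitely
    many closed ones, Tietze's theorem produces a continuous [a_n], also vanishing
    where a coefficient must for [a_n u^n] to be in the subalgebra.  The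
    finite sum of the [a_n u^n] is a preimage of [b], so [gamma_l] is onto [R_l]
    for every [l] ([gamma_surj]).

    Surjectivity gives the attaching maps.  If [b = gamma_l a], then the
    last component of [gamma_(l+1) a], restricted to [D_(l+1)], is determined by
    [b] through the [beta_(l+1, mu)]; define [beta_(l+1) b] to be this restriction
    ([attach]).  That it is a homomorphism with continuous values is inherited
    from [gamma_(l+1)], and the pullback description of [R_(l+1)] says that
    the sets [T_(l+1, mu)] cover [D_(l+1)].

    Finally, if the translates of [Y] cover [X], then every point lies in a
    tower over [Y] of height at most [r_m] ([tower_cover]), so the elements of
    the subalgebra have no coefficients in degrees [r_m] and beyond, and are
    equal to their finite Fourier sums ([orbit_breaking_fourier]).  An element
    killed by [gamma_m] has no nonzero coefficient, so it is zero
    ([gamma_inj]). *)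

Set Implicit Arguments.
Unset Strict Implicit.
Unset Printing Implicit Defensive.

Import Order.TTheory GRing.Theory Num.Theory.
Import numFieldNormedType.Exports.

Local Open Scope classical_set_scope.
Local Open Scope ring_scope.

(** * C*-algebras and generated subalgebras *)

Section ClosedSets.
Variables (C : numClosedFieldType).

Lemma closed_approx (V : normedModType C) (S : set V) :
  (forall a, (forall e : C, 0 < e -> exists2 b, S b & `|a - b| < e :> C) -> S a) ->
  closed S.
Proof.
move=> h a cla; apply: h => e e0.
have [b [Sb]] := cla _ (nbhsx_ballx a e e0).
by rewrite -ball_normE /= => ab; exists b.
Qed.

Lemma closed_lim (V : normedModType C) (S : set V) : closed S ->
  forall a, (forall e : C, 0 < e -> exists2 b, S b & `|a - b| < e :> C) -> S a.
Proof.
move=> clS a h; apply: clS => B /nbhs_ballP [e e0 Be].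
have [b Sb ab] := h e e0; exists b; split=> //; apply: Be.
by rewrite -ball_normE.
Qed.

(** Bounded additive maps are continuous; this is how every identity between
    Fourier coefficients below is seen to define a closed set. *)
Lemma closed_ker (V W : normedModType C) (D : V -> W) (K : C) : 0 <= K ->
  (forall a b, D (a - b) = D a - D b) -> (forall a, `|D a| <= K * `|a|) ->
  closed [set a | D a = 0].
Proof.
move=> K0 DB Dle; apply: closed_approx => a h /=.
apply/eqP; rewrite -normr_eq0; apply/negPn/negP => n0.
have Dp : 0 < `|D a| by rewrite lt_def n0 normr_ge0.
have K1 : 0 < K + 1 by rewrite ltr_wpDl.
(* [K + 1], as [K] may be zero. *)
have [b Db ab] := h (`|D a| / (K + 1)) (divr_gt0 Dp K1).
have : `|D a| < `|D a|.
  rewrite -{1}[D a]subr0 -Db -DB (le_lt_trans (Dle _))//.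
  rewrite (@le_lt_trans _ _ ((K + 1) * `|a - b|))//.
    by rewrite ler_wpM2r// lerDl.
  by rewrite mulrC -ltr_pdivlMr.
by rewrite ltxx.
Qed.

End ClosedSets.

Section StarAlgebraTheory.
Variables (C : numClosedFieldType) (A : starAlgType C).
Implicit Types (a b : A).

Lemma amul0l b : (0 : A) ** b = 0.
Proof. by rewrite -[0 in LHS](scale0r 0) amulZl scale0r. Qed.

Lemma amul0r a : a ** (0 : A) = 0.
Proof. by rewrite -[0 in LHS](scale0r 0) amulZr scale0r. Qed.

Lemma amulNl a b : (- a) ** b = - (a ** b).
Proof. by rewrite -scaleN1r amulZl scaleN1r. Qed.

Lemma amulNr a b : a ** (- b) = - (a ** b).
Proof. by rewrite -scaleN1r amulZr scaleN1r. Qed.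

Lemma amulBl a a' b : (a - a') ** b = a ** b - a' ** b.
Proof. by rewrite amulDl amulNl. Qed.

Lemma amulBr a b b' : a ** (b - b') = a ** b - a ** b'.
Proof. by rewrite amulDr amulNr. Qed.

Lemma amul_sumr I (s : seq I) (P : pred I) a (F : I -> A) :
  a ** (\sum_(i <- s | P i) F i) = \sum_(i <- s | P i) a ** F i.
Proof.
elim/big_rec2: _ => [|i y1 y2 _ <-]; first exact: amul0r.
exact: amulDr.
Qed.

Lemma star1 : star (aone : A) = aone.
Proof. by rewrite -[LHS]amul1r -{2}(starK aone) -starM amul1r starK. Qed.

Lemma star0 : star (0 : A) = 0.
Proof. by rewrite -[0 in LHS](scale0r 0) starZ rmorph0 scale0r. Qed.

Lemma starN a : star (- a) = - star a.
Proof. by rewrite -scaleN1r starZ rmorphN1 scaleN1r. Qed.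

Lemma starB a b : star (a - b) = star a - star b.
Proof. by rewrite starD starN. Qed.

End StarAlgebraTheory.

Section CStarTheory.
Variables (C : numClosedFieldType) (A : cstarAlgType C).
Implicit Types (a b : A).

Lemma norm_star a : `|star a| = `|a|.
Proof.
have le x : `|x| <= `|star x| :> C.
  have [->|x0] := eqVneq x 0; first by rewrite normr0.
  rewrite -(ler_pM2r (x := `|x|)) ?normr_gt0// -expr2 -cstar_norm.
  exact: cstar_normM.
by apply/eqP; rewrite eq_le le andbT -{2}(starK a) le.
Qed.

Lemma norm_aone_le1 : `|aone : A| <= 1.
Proof.
have /eqP := @cstar_norm C A aone; rewrite star1 amul1l expr2.
have [->//|n0] := eqVneq `|aone : A| 0.
by rewrite -{1}[`|_|]mulr1 => /eqP/(mulfI n0) <-.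
Qed.

(** By the C*-identity; the norm of the unit itself is 0 or 1, since the zero
    algebra is allowed. *)
Lemma norm_isometry_le1 a : star a ** a = aone -> `|a| <= 1.
Proof.
move=> e; rewrite -(ler_pXn2r (n := 2))// ?nnegrE// expr1n -cstar_norm e.
exact: norm_aone_le1.
Qed.

Lemma cstar_generated_subalgebra (G : set A) : cstar_subalgebra (cstar_generated G).
Proof.
split.
- by apply: closed_bigI => S [sS _]; exact: csub_closed.
- by move=> S [sS _]; exact: csub0.
- by move=> a b ha hb S hS; apply: csubD; [exact: hS.1|exact: ha|exact: hb].
- by move=> k a ha S hS; apply: csubZ; [exact: hS.1|exact: ha].
- by move=> a b ha hb S hS; apply: csubM; [exact: hS.1|exact: ha|exact: hb].
- by move=> a ha S hS; apply: csub_star; [exact: hS.1|exact: ha].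
Qed.

(** The elements [a] for which both [a] and its adjoint preserve [V] form a
    C*-subalgebra, so it is enough to test generators. *)
Lemma generated_left_invariant (G V : set A) :
  closed V -> V 0 -> (forall a b, V a -> V b -> V (a + b)) ->
  (forall (k : C) a, V a -> V (k *: a)) ->
  (forall g v, G g -> V v -> V (g ** v) /\ V (star g ** v)) ->
  forall a v, cstar_generated G a -> V v -> V (a ** v).
Proof.
move=> clV V0 VD VZ VG a v Ga.
pose M := [set a : A | forall v, V v -> V (a ** v) /\ V (star a ** v)].
suff : M a by move=> Ma Vv; have [] := Ma v Vv.
apply: (Ga M); split; last by move=> g Gg w Vw; exact: VG.
have aux (b w : A) (f : A -> A) : {morph f : x y / x - y} ->
    (forall x, `|f x| = `|x|) ->
    (forall e : C, 0 < e -> exists2 c, V (f c ** w) & `|b - c| < e) ->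
    V (f b ** w).
  move=> fB fn h; apply: (closed_lim clV) => e e0.
  have w1 : 0 < `|w| + 1 by rewrite ltr_wpDl.
  have [c Vc bc] := h _ (divr_gt0 e0 w1).
  exists (f c ** w) => //; rewrite -amulBl -fB.
  rewrite (le_lt_trans (cstar_normM _ _))// fn.
  rewrite (@le_lt_trans _ _ (`|b - c| * (`|w| + 1)))//.
    by rewrite ler_wpM2l// lerDl.
  by rewrite -ltr_pdivlMr.
split.
- apply: closed_approx => b h w Vw; split.
    apply: (aux b w id) => // e e0; have [c Mc bc] := h e e0.
    by exists c => //; have [] := Mc w Vw.
  apply: (aux b w star); [exact: starB|exact: norm_star|] => e e0.
  by have [c Mc bc] := h e e0; exists c => //; have [] := Mc w Vw.
- by move=> w _; rewrite star0 !amul0l.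
- move=> b c Mb Mc w Vw; have [? ?] := Mb w Vw; have [? ?] := Mc w Vw.
  by rewrite starD !amulDl; split; exact: VD.
- move=> k b Mb w Vw; have [? ?] := Mb w Vw.
  by rewrite starZ !amulZl; split; exact: VZ.
- move=> b c Mb Mc w Vw; rewrite starM -!amulA; split.
    by have [] := Mb _ (Mc w Vw).1.
  by have [] := Mc _ (Mb w Vw).2.
- by move=> b Mb w Vw; rewrite starK; have [] := Mb w Vw.
Qed.

End CStarTheory.

(** * Integer iterates and continuous functions *)

Section IntegerIterates.
Variables (X : Type) (h hinv : X -> X).
Hypotheses (hK : cancel h hinv) (hinvK : cancel hinv h).
Local Notation z := (ziter h hinv).

Lemma ziterS n x : z (n + 1) x = h (z n x).
Proof.
case: n => [k|[|k]].
  by have -> : Posz k + 1 = Posz k.+1 by lia.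
  have -> : Negz 0 + 1 = 0 by lia.
  by rewrite /= hinvK.
have -> : Negz k.+1 + 1 = Negz k by lia.
by rewrite /= hinvK.
Qed.

Lemma ziterB1 n x : z (n - 1) x = hinv (z n x).
Proof. by rewrite -{2}(subrK 1 n) ziterS hK. Qed.

Lemma ziterD m n x : z (m + n) x = z m (z n x).
Proof.
elim/int_rect: m => [|m IH|m IH]; first by rewrite add0r.
  have -> : m.+1%:Z = m%:Z + 1 by lia.
  by rewrite addrAC !ziterS IH.
have -> : - m.+1%:Z = - m%:Z - 1 by lia.
by rewrite addrAC !ziterB1 IH.
Qed.

End IntegerIterates.

Lemma ziter_continuous (X : topologicalType) (h hinv : X -> X) n :
  continuous h -> continuous hinv -> continuous (ziter h hinv n).
Proof.
move=> ch chi.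
have it f k : continuous f -> continuous (iter k f : X -> X).
  move=> cf; elim: k => [|k IH] x; first exact: cvg_id.
  by apply: (@continuous_comp _ _ _ (iter k f) f); [exact: IH|exact: cf].
by case: n => k; exact: it.
Qed.

(** Applied to conjugation and to the modulus. *)
Lemma scalar_nonexpansive_continuous (C : numClosedFieldType)
    (g : C^o -> C^o) :
  (forall a b, `|g a - g b| <= `|a - b|) -> continuous g.
Proof.
move=> hg x B /nbhs_ballP [e e0 eB]; apply/nbhs_ballP; exists e => //= y xy.
apply: eB; move: xy; rewrite -!ball_normE /=; apply: le_lt_trans; exact: hg.
Qed.

Section ContinuousFunctions.
Variables (C : numClosedFieldType) (X : topologicalType).
Local Notation CX := (contfun C X).
Implicit Types f g : X -> C^o.

Lemma continuous_at_scalarP f x : {for x, continuous f} <->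
  forall e : C, 0 < e -> nbhs x [set y | `|(f x : C) - f y| < e].
Proof.
split=> [cf e e0|cf B /nbhs_ballP [e e0 eB]].
  have nb : nbhs x (f @^-1` ball (f x) e) := cf _ (@nbhsx_ballx C C^o (f x) e e0).
  by apply: filterS nb => y; rewrite /= -ball_normE.
change (nbhs x (f @^-1` B)).
by apply: filterS (cf e e0) => y /= fxy; apply: eB; rewrite -ball_normE.
Qed.

Lemma contfunP f : CX f <->
  forall x (e : C), 0 < e -> nbhs x [set y | `|(f x : C) - f y| < e].
Proof. by split=> cf x; apply/continuous_at_scalarP; exact: cf. Qed.

Lemma contfun_cst (c : C) : CX (fun=> c : C^o).
Proof. by move=> x; exact: cvg_cst. Qed.

Lemma contfun0 : CX 0.
Proof. exact: contfun_cst. Qed.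

Lemma contfun_comp f (g : X -> X) : CX f -> continuous g -> CX (f \o g).
Proof. by move=> cf cg x; apply: continuous_comp; [exact: cg|exact: cf]. Qed.

Lemma contfunD f g : CX f -> CX g -> CX (f + g).
Proof. by move=> cf cg x; apply: cvgD; [exact: cf|exact: cg]. Qed.

Lemma contfunB f g : CX f -> CX g -> CX (f - g).
Proof. by move=> cf cg x; apply: cvgB; [exact: cf|exact: cg]. Qed.

Lemma contfunM f g : CX f -> CX g -> CX (f ** g).
Proof. by move=> cf cg x; apply: cvgM; [exact: cf|exact: cg]. Qed.

Lemma contfunZ (k : C) f : CX f -> CX (k *: f).
Proof. by move=> cf x; apply: cvgZr; exact: cf. Qed.

Lemma contfun_star f : CX f -> CX (star f).
Proof.
move=> cf x.
apply: (@continuous_comp _ _ _ f (fun a : C^o => Num.conj (a : C) : C^o)).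
  exact: cf.
apply: scalar_nonexpansive_continuous => a b.
by rewrite -rmorphB norm_conjC.
Qed.

Lemma contfun_norm f : CX f -> CX (fun x => `|f x|).
Proof.
move=> cf x.
apply: (@continuous_comp _ _ _ f (fun a : C^o => `|a : C| : C^o)).
  exact: cf.
apply: scalar_nonexpansive_continuous => a b.
exact: ler_dist_dist.
Qed.

End ContinuousFunctions.

(** * Fourier coefficients in the crossed product *)

Section UnitaryPowers.
Variables (C : numClosedFieldType) (A : cstarAlgType C) (u : A).
Hypotheses (uV : star u ** u = aone) (uK : u ** star u = aone).

Lemma upowS n : upow u (n + 1) = u ** upow u n.
Proof.
case: n => [k|[|k]].
- by have -> : Posz k + 1 = Posz k.+1 by lia; exact: erefl.
- have -> : Negz 0 + 1 = 0 by lia.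
  by rewrite /= /apow /= amul1r uK.
have -> : Negz k.+1 + 1 = Negz k by lia.
by rewrite /= /apow /= [RHS]amulA uK amul1l.
Qed.

Lemma upowB1 n : upow u (n - 1) = star u ** upow u n.
Proof. by rewrite -[in RHS](subrK 1 n) upowS amulA uV amul1l. Qed.

Lemma upowD m n : upow u (m + n) = upow u m ** upow u n.
Proof.
elim/int_rect: m => [|m IH|m IH]; first by rewrite add0r amul1l.
  have -> : m.+1%:Z = m%:Z + 1 by lia.
  by rewrite addrAC !upowS IH amulA.
have -> : - m.+1%:Z = - m%:Z - 1 by lia.
by rewrite addrAC !upowB1 IH amulA.
Qed.

Lemma star_upow n : star (upow u n) = upow u (- n).
Proof.
have com k : upow u k ** u = u ** upow u k.
  by rewrite -upowS upowD /= /apow /= amul1r.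
have comV k : upow u k ** star u = star u ** upow u k.
  by rewrite -upowB1 upowD [upow u (- 1)]/= /apow /= amul1r.
elim/int_rect: n => [|m IH|m IH]; first by rewrite oppr0 star1.
  have -> : m.+1%:Z = m%:Z + 1 by lia.
  by rewrite upowS starM IH opprD upowB1 comV.
have -> : - m.+1%:Z = - m%:Z - 1 by lia.
by rewrite upowB1 starM IH starK opprB addrC upowS com opprK.
Qed.

Lemma norm_upow n : `|upow u n| <= 1.
Proof. by apply: norm_isometry_le1; rewrite star_upow -upowD addNr. Qed.

End UnitaryPowers.

Section Coefficients.
Variables (C : numClosedFieldType) (X : topologicalType) (h hinv : X -> X).
Hypotheses (hK : cancel h hinv) (hinvK : cancel hinv h).
Hypotheses (h_cont : continuous h) (hinv_cont : continuous hinv).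
Variables (A : cstarAlgType C) (iota : (X -> C^o) -> A) (u : A).
Hypothesis cpA : crossed_product hinv iota u.
Variable E : A -> X -> C^o.
Hypothesis stdE : standard_expectation iota u E.

Local Notation CX := (contfun C X).
Local Notation z := (ziter h hinv).
Local Notation coef := (coef u E).

Lemma cp_iota : star_hom CX setT iota.
Proof. exact: cov_hom (cp_covariant cpA). Qed.

Lemma cp_uV : star u ** u = aone.
Proof. exact: (cov_unitary (cp_covariant cpA)).1. Qed.

Lemma cp_uK : u ** star u = aone.
Proof. exact: (cov_unitary (cp_covariant cpA)).2. Qed.

Let uD := upowD cp_uV cp_uK.

Lemma iota0 : iota 0 = 0.
Proof.
have := star_homZ cp_iota 0 (@contfun0 C X).
by rewrite !scale0r.
Qed.

Lemma u_iota f : CX f -> u ** iota f = iota (f \o hinv) ** u.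
Proof.
move=> cf; rewrite -(cov_conj (cp_covariant cpA) cf).
by rewrite -!amulA cp_uV amul1r.
Qed.

Lemma ustar_iota f : CX f -> star u ** iota f = iota (f \o h) ** star u.
Proof.
move=> cf.
have -> : f = (f \o h) \o hinv by apply/funext => x /=; rewrite hinvK.
have cfh := contfun_comp cf h_cont.
rewrite -(cov_conj (cp_covariant cpA) cfh) !amulA cp_uV amul1l.
by congr (iota _ ** _); apply/funext => x /=; rewrite hinvK.
Qed.

(** The covariance relation, iterated: [u^n f = (f o h^(-n)) u^n]. *)
Lemma upow_iota n f : CX f ->
  upow u n ** iota f = iota (f \o z (- n)) ** upow u n.
Proof.
elim/int_rect: n => [|m IH|m IH] cf.
- by rewrite /= /apow /= amul1l amul1r; congr iota; apply/funext.
- have -> : m.+1%:Z = m%:Z + 1 by lia.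
  have cz := contfun_comp cf (ziter_continuous (n := - m%:Z) h_cont hinv_cont).
  rewrite (upowS cp_uK) -amulA IH// amulA u_iota// -amulA; congr (iota _ ** _).
  apply/funext => x /=.
  by rewrite -[hinv x](ziterB1 hK hinvK 0 x) -(ziterD hK hinvK) sub0r opprD.
- have -> : - m.+1%:Z = - m%:Z - 1 by lia.
  have cz := contfun_comp cf (ziter_continuous (n := - - m%:Z) h_cont hinv_cont).
  rewrite (upowB1 cp_uV cp_uK) -amulA IH// amulA ustar_iota// -amulA.
  congr (iota _ ** _); apply/funext => x /=.
  by rewrite -[h x](ziterS hinvK 0 x) -(ziterD hK hinvK) add0r !opprD.
Qed.

(** The monomials [f u^n] span a dense subspace.  A closed subspace [Q] containing
    them need not be invariant under anything, but the set of all [b] with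
    [f u^n b] in [Q] for every [f] and [n] is invariant under left multiplication by
    the generators, since these permute the monomials. *)
Lemma span_dense (Q : set A) : closed Q -> Q 0 ->
  (forall a b, Q a -> Q b -> Q (a + b)) ->
  (forall (k : C) a, Q a -> Q (k *: a)) ->
  (forall f n, CX f -> Q (iota f ** upow u n)) -> forall a, Q a.
Proof.
move=> clQ Q0 QD QZ Qmono a.
pose V := [set b | forall f n, CX f -> Q (iota f ** upow u n ** b)].
suff : V (a ** aone).
  move=> /(_ aone 0 (@contfun_cst C X 1)).
  by rewrite (star_hom1 cp_iota) !amul1l amul1r.
have Ga : cstar_generated (iota @` CX `|` [set u]) a by rewrite (cp_generated cpA).
apply: generated_left_invariant Ga _.
- apply: closed_approx => b hb f n cf; apply: (closed_lim clQ) => e e0.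
  have w1 : 0 < `|iota f ** upow u n| + 1 :> C by rewrite ltr_wpDl.
  have [c Vc bc] := hb _ (divr_gt0 e0 w1).
  exists (iota f ** upow u n ** c); first exact: Vc.
  rewrite -amulBr (le_lt_trans (cstar_normM _ _))//.
  rewrite (@le_lt_trans _ _ ((`|iota f ** upow u n| + 1) * `|b - c|))//.
    by rewrite ler_wpM2r// lerDl.
  by rewrite mulrC -ltr_pdivlMr.
- by move=> f n _; rewrite amul0r.
- by move=> b c Vb Vc f n cf; rewrite amulDr; apply: QD; [exact: Vb|exact: Vc].
- by move=> k b Vb f n cf; rewrite amulZr; apply: QZ; exact: Vb.
- have Viota g b : CX g -> V b -> V (iota g ** b).
    move=> cg Vb f n cf.
    rewrite amulA -[_ ** iota g]amulA upow_iota// amulA.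
    have cgz := contfun_comp cg (ziter_continuous (n := - n) h_cont hinv_cont).
    by rewrite -(star_homM cp_iota)//; apply: Vb; exact: contfunM.
  move=> g b [[f cf <-]|->] Vb.
    split; first exact: Viota.
    by rewrite -(star_hom_star cp_iota)//; apply: Viota => //; exact: contfun_star.
  have e1 : u = upow u 1 by rewrite /= /apow /= amul1r.
  have e2 : star u = upow u (- 1) by rewrite /= /apow /= amul1r.
  split=> f n cf.
    by rewrite {2}e1 amulA -[_ ** upow u 1]amulA -uD; exact: Vb.
  by rewrite e2 amulA -[_ ** upow u _]amulA -uD; exact: Vb.
- by move=> f n cf; rewrite amul1r; exact: Qmono.
Qed.

Lemma fcoefD a b n x : coef (a + b) n x = coef a n x + coef b n x.
Proof. by rewrite /coef amulDl (sexpD stdE). Qed.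

Lemma fcoefZ (k : C) a n x : coef (k *: a) n x = k * coef a n x.
Proof. by rewrite /coef amulZl (sexpZ stdE). Qed.

Lemma fcoefN a n x : coef (- a) n x = - coef a n x.
Proof. by rewrite -scaleN1r fcoefZ mulN1r. Qed.

Lemma fcoefB a b n x : coef (a - b) n x = coef a n x - coef b n x.
Proof. by rewrite fcoefD fcoefN. Qed.

Lemma fcoef0 n x : coef 0 n x = 0.
Proof. by rewrite -(subrr 0) fcoefB subrr. Qed.

Lemma coef_le a n x : `|coef a n x| <= `|a|.
Proof.
rewrite (le_trans (sexp_contractive stdE _ _))// (le_trans (cstar_normM _ _))//.
by rewrite ler_piMr// norm_upow// (cp_uV, cp_uK).
Qed.

Lemma coef_mono f k n x : CX f ->
  coef (iota f ** upow u k) n x = if n == k then f x else 0.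
Proof.
move=> cf; rewrite /coef -amulA -uD (sexp_mono stdE)// subr_eq0 eq_sym.
by case: ifP.
Qed.

(** A bounded linear functional is determined by its values on monomials; the
    module properties of the coefficients follow, as both sides are bounded and linear. *)
Lemma coef_determined (D : A -> C) (K : C) : 0 <= K ->
  (forall a b, D (a + b) = D a + D b) -> (forall k a, D (k *: a) = k * D a) ->
  (forall a, `|D a| <= K * `|a|) ->
  (forall f n, CX f -> D (iota f ** upow u n) = 0) -> forall a, D a = 0.
Proof.
move=> K0 DD DZ Dle D0 a; apply: (@span_dense [set a | D a = 0]) => //=.
- apply: (@closed_ker C A C^o D K) => // b c.
  by rewrite -scaleN1r DD DZ mulN1r.
- by rewrite -(scale0r 0) DZ mul0r.
- by move=> b c Db Dc; rewrite DD Db Dc addr0.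
- by move=> k b Db; rewrite DZ Db mulr0.
Qed.

Lemma coef_iotaM f a n x : CX f ->
  coef (iota f ** a) n x = f x * coef a n x.
Proof.
move=> cf; apply/eqP; rewrite -subr_eq0; apply/eqP; move: a.
apply: (@coef_determined _ (`|iota f| + `|f x|)).
- exact: addr_ge0.
- by move=> a b; rewrite amulDr !fcoefD; ring.
- by move=> k a; rewrite amulZr !fcoefZ; ring.
- move=> a; rewrite (le_trans (ler_normB _ _))// mulrDl lerD//.
    exact: le_trans (coef_le _ _ _) (cstar_normM _ _).
  by rewrite normrM ler_wpM2l// coef_le.
- move=> g k cg; rewrite amulA -(star_homM cp_iota)// !coef_mono//.
    by case: ifP => _; rewrite ?mulr0 subrr.
  exact: contfunM.
Qed.

Lemma coef_uM a n x : coef (u ** a) n x = coef a (n - 1) (hinv x).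
Proof.
apply/eqP; rewrite -subr_eq0; apply/eqP; move: a.
apply: (@coef_determined _ (`|u| + 1)).
- exact: addr_ge0.
- by move=> a b; rewrite amulDr !fcoefD; ring.
- by move=> k a; rewrite amulZr !fcoefZ; ring.
- move=> a; rewrite (le_trans (ler_normB _ _))// mulrDl lerD//.
    exact: le_trans (coef_le _ _ _) (cstar_normM _ _).
  by rewrite mul1r coef_le.
- move=> g k cg; rewrite amulA u_iota// -amulA -(upowS cp_uK) !coef_mono//.
    by rewrite subr_eq; case: ifP => _; rewrite subrr.
  exact: contfun_comp.
Qed.

Lemma coef_ustarM a n x : coef (star u ** a) n x = coef a (n + 1) (h x).
Proof. by rewrite -{2}[a]amul1l -cp_uK -amulA coef_uM addrK hK. Qed.

(** Formally the matrix of [a] in the regular representation on the square summable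
    functions on the integers that is induced from evaluation at [y]. *)
Definition orbmx a y (j k : int) : C := coef a (j - k) (z j y).

Lemma orbmx_iotaM f a y j k : CX f ->
  orbmx (iota f ** a) y j k = f (z j y) * orbmx a y j k.
Proof. exact: coef_iotaM. Qed.

Lemma orbmx_uM a y j k : orbmx (u ** a) y j k = orbmx a y (j - 1) k.
Proof. by rewrite /orbmx coef_uM -ziterB1// addrAC. Qed.

Lemma orbmx_ustarM a y j k : orbmx (star u ** a) y j k = orbmx a y (j + 1) k.
Proof. by rewrite /orbmx coef_ustarM -ziterS// addrAC. Qed.

Lemma orbmx1 y j k : orbmx aone y j k = (j == k)%:R.
Proof.
have -> : aone = iota aone ** upow u 0 by rewrite (star_hom1 cp_iota) amul1l.
rewrite /orbmx coef_mono ?subr_eq0; last exact: (@contfun_cst C X 1).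
by case: ifP.
Qed.

End Coefficients.

(** * Square roots and contractivity of homomorphisms *)

Section SquareRoots.
Variables (C : numClosedFieldType) (X : topologicalType).
Local Notation CX := (contfun C X).

(** From the inequality [(sqrt s - sqrt t)^2 <= |s - t|] for nonnegative [s] and
    [t]. *)
Lemma contfun_sqrt (g : X -> C^o) : CX g -> (forall x, 0 <= (g x : C)) ->
  CX (fun x => sqrtC (g x) : C^o).
Proof.
move=> /contfunP cg g0; apply/contfunP => x e e0.
have e2 : 0 < e ^+ 2 :> C by rewrite exprn_gt0.
apply: filterS (cg x _ e2) => y /= gxy.
rewrite -(ltr_pXn2r (n := 2)) ?nnegrE ?(ltW e0)//.
apply: le_lt_trans gxy; have -> : (g x : C) - g y = sqrtC (g x) ^+ 2 - sqrtC (g y) ^+ 2.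
  by rewrite !sqrtCK.
rewrite subr_sqr normrM expr2 ler_wpM2l//.
have sx : 0 <= sqrtC (g x) by rewrite sqrtC_ge0.
have sy : 0 <= sqrtC (g y) by rewrite sqrtC_ge0.
by rewrite (le_trans (ler_normB _ _))// !ger0_norm// addr_ge0.
Qed.

(** Take [s] the square root of [|f|] and [g = f / s]: the modulus of [g] is [s], so
    [g] extends continuously by zero to the zeros of [f]. *)
Lemma contfun_factor (f : X -> C^o) : CX f -> exists g s : X -> C^o,
  [/\ CX g, CX s, f = g ** s & forall x, f x = 0 -> g x = 0 /\ s x = 0].
Proof.
move=> cf; pose s x : C := sqrtC `|f x|.
have s0 x : 0 <= s x by rewrite sqrtC_ge0.
have cs : CX (s : X -> C^o).
  by apply: contfun_sqrt => [|x]; [exact: contfun_norm|exact: normr_ge0].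
have nf x : `|f x : C| = s x * s x by rewrite -expr2 sqrtCK.
have gs x : `|(f x : C) / s x| = s x.
  rewrite normrM normfV (ger0_norm (s0 x)) nf.
  by have [->|sn] := eqVneq (s x) 0; rewrite ?mul0r ?mulfK.
exists (fun x => (f x : C) / s x), s; split=> //.
- move=> x; have [sx|sx] := eqVneq (s x) 0.
    have f0 : (f x : C) / s x = 0 by apply/eqP; rewrite -normr_eq0 gs sx.
    apply/continuous_at_scalarP => e e0.
    move: cs => /contfunP /(_ x e e0); apply: filterS => y /=.
    by rewrite f0 sx !sub0r !normrN gs ger0_norm.
  by apply: cvgM; [exact: cf|apply: cvgV => //; exact: cs].
- apply/funext => x; rewrite /= /amul /= /fct_mul /= /amul /= /scalar_mul.
  have [sx|sx] := eqVneq (s x) 0; last by rewrite divfK.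
  by rewrite sx mulr0; apply/eqP; rewrite -normr_eq0 nf sx mulr0.
- by move=> x fx; rewrite fx mul0r /s fx normr0 sqrtC0.
Qed.

Variables (A : cstarAlgType C) (phi : (X -> C^o) -> A).
Hypothesis hom : star_hom CX setT phi.

Let conj_real_imag (a b : C) : a \is Num.real -> b \is Num.real ->
  (a + 'i * b)^* = a - 'i * b.
Proof.
move=> ra rb; rewrite rmorphD rmorphM /= conjCi mulNr.
by rewrite (CrealP ra) (CrealP rb).
Qed.

Let circle_unitary (a b : C) : a \is Num.real -> b \is Num.real ->
  b ^+ 2 = 1 - a ^+ 2 -> (a + 'i * b)^* * (a + 'i * b) = 1.
Proof.
move=> ra rb b2; rewrite conj_real_imag//.
have -> : (a - 'i * b) * (a + 'i * b) = a ^+ 2 - 'i ^+ 2 * b ^+ 2 by ring.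
rewrite sqrCi b2; by rewrite mulN1r opprK addrC subrK.
Qed.

Let circle_real (a b : C) : a \is Num.real -> b \is Num.real ->
  a = 2^-1 * ((a + 'i * b) + (a + 'i * b)^*).
Proof. by move=> ra rb; rewrite conj_real_imag//; field. Qed.

(** A real [f] of modulus at most 1 is the real part of the unitary
    [f + i sqrt(1 - f^2)], and unitaries are mapped to elements of norm at most 1.
    So no spectral theory is needed for the contractivity of [phi]. *)
Lemma norm_hom_real_le1 (f : X -> C^o) : CX f ->
  (forall x, (f x : C) \is Num.real) -> (forall x, `|f x : C| <= 1) ->
  `|phi f| <= 1.
Proof.
move=> cf fr f1; pose g x : C := sqrtC (1 - (f x : C) ^+ 2).
have f2 x : 0 <= 1 - (f x : C) ^+ 2.
  by rewrite subr_ge0 -real_normK// expr_le1.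
have g0 x : 0 <= g x by rewrite sqrtC_ge0.
have cg : CX (g : X -> C^o).
  apply: contfun_sqrt => //; apply: (@contfunB _ _ (fun=> 1)).
    exact: contfun_cst.
  by rewrite (_ : (fun _ => _) = f ** f)//; exact: contfunM.
pose v : X -> C^o := f + ('i : C) *: (g : X -> C^o).
have cv : CX v by apply: contfunD => //; exact: contfunZ.
have sv : star v ** v = aone.
  apply/funext => x; apply: (@circle_unitary (f x) (g x)) => //.
    exact: ger0_real.
  by rewrite /g sqrtCK.
have nv : `|phi v| <= 1.
  apply: norm_isometry_le1; rewrite -(star_hom_star hom)// -(star_homM hom)//.
    by rewrite sv (star_hom1 hom).
  exact: contfun_star.
have -> : f = (2^-1 : C) *: (v + star v).
  by apply/funext => x; apply: (@circle_real (f x) (g x)) => //; exact: ger0_real.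
have csv := contfun_star cv.
rewrite (star_homZ hom); last exact: contfunD.
rewrite (star_homD hom)// (star_hom_star hom)//.
rewrite normrZ gtr0_norm ?invr_gt0 ?ltr0n// mulrC ler_pdivrMr ?ltr0n//.
by rewrite (le_trans (ler_normD _ _))// norm_star mul1r lerD.
Qed.

(** The C*-identity reduces this to the nonnegative function [|f|^2]. *)
Lemma norm_hom_le (f : X -> C^o) (c : C) : CX f -> 0 < c ->
  (forall x, `|f x : C| <= c) -> `|phi f| <= c.
Proof.
move=> cf c0 fc.
have cn : CX (star f ** f) by apply: contfunM => //; exact: contfun_star.
have nn x : (star f ** f) x = `|f x : C| ^+ 2 :> C.
  by rewrite normCK mulrC.
have le1 : `|phi (c ^- 2 *: (star f ** f))| <= 1.
  apply: norm_hom_real_le1; first exact: contfunZ.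
    move=> x; change (c ^- 2 * (star f ** f) x \is Num.real); rewrite nn.
    by rewrite realM ?realV ?realX ?normr_real ?gtr0_real.
  move=> x; change (`|c ^- 2 * (star f ** f) x| <= 1); rewrite nn.
  rewrite ger0_norm; last by rewrite mulr_ge0 ?invr_ge0 ?exprn_ge0 ?(ltW c0).
  by rewrite mulrC ler_pdivrMr ?exprn_gt0// mul1r lerXn2r ?nnegrE// ltW.
move: le1; rewrite (star_homZ hom)// (star_homM hom)//; last exact: contfun_star.
rewrite (star_hom_star hom)// normrZ cstar_norm.
rewrite ger0_norm ?invr_ge0 ?exprn_ge0 ?(ltW c0)// mulrC.
rewrite ler_pdivrMr ?exprn_gt0// mul1r ler_pXn2r ?nnegrE//.
exact: ltW.
Qed.

End SquareRoots.

(** * The orbit-breaking subalgebra *)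

(** The row of a weighted shift, restricted to a window of [N] indices. *)
Lemma sum_ord_delta (C : pzRingType) (N : nat) (t : int) (w F : int -> C) :
  \sum_(i < N) w i * (t == i%:Z)%:R * F i =
  if (0 <= t) && (t < N) then w t * F t else 0.
Proof.
case: ifP => tN.
  have tN' : (`|t| < N)%N by lia.
  have et : t = (Ordinal tN')%:Z by rewrite /=; lia.
  rewrite (bigD1 (Ordinal tN'))//= big1 ?addr0; last first.
    move=> i /eqP ni; rewrite et /= (_ : (_ == _) = false) ?mulr0 ?mul0r//.
    by apply/negP => /eqP [] e; apply: ni; apply: val_inj.
  by rewrite -et eqxx mulr1.
rewrite big1// => i _; rewrite (_ : (_ == _) = false) ?mulr0 ?mul0r//.
by have := ltn_ord i; lia.
Qed.

Section OrbitBreaking.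
Variables (C : numClosedFieldType) (X : topologicalType) (h hinv : X -> X).
Hypotheses (hK : cancel h hinv) (hinvK : cancel hinv h).
Hypotheses (h_cont : continuous h) (hinv_cont : continuous hinv).
Variables (A : cstarAlgType C) (iota : (X -> C^o) -> A) (u : A).
Hypothesis cpA : crossed_product hinv iota u.
Variable E : A -> X -> C^o.
Hypothesis stdE : standard_expectation iota u E.
Variable Y : set X.

Local Notation CX := (contfun C X).
Local Notation z := (ziter h hinv).
Local Notation coef := (coef u E).
Local Notation orbmx := (orbmx h hinv u E).
Local Notation AY := (orbit_breaking iota u Y).

Let hom := cp_iota cpA.
Let iotaM := orbmx_iotaM hK hinvK h_cont hinv_cont cpA stdE.
Let uM := orbmx_uM hK hinvK h_cont hinv_cont cpA stdE.
Let ustarM := orbmx_ustarM hK hinvK h_cont hinv_cont cpA stdE.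

Let orbmx_le a y j k : `|orbmx a y j k| <= `|a|.
Proof. exact: (coef_le cpA stdE a (j - k) (z j y)). Qed.

Let orbmxB a b y j k : orbmx (a - b) y j k = orbmx a y j k - orbmx b y j k.
Proof. exact (fcoefB stdE a b (j - k) (z j y)). Qed.

Lemma orbit_breaking_subalgebra : cstar_subalgebra AY.
Proof. exact: cstar_generated_subalgebra. Qed.

Lemma orbit_breaking_iota f : CX f -> AY (iota f).
Proof. by move=> cf S [_ GS]; apply: GS; left; exists f. Qed.

Lemma orbit_breaking_iotau f : CX f -> (forall y, Y y -> f y = 0) -> AY (iota f ** u).
Proof. by move=> cf f0 S [_ GS]; apply: GS; right; exists f. Qed.

Lemma orbit_breaking1 : AY aone.
Proof. by rewrite -(star_hom1 hom); apply: orbit_breaking_iota; exact: (@contfun_cst C X 1). Qed.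

Lemma orbit_breaking_sum I (s : seq I) (P : pred I) (F : I -> A) :
  (forall i, AY (F i)) -> AY (\sum_(i <- s | P i) F i).
Proof.
move=> AF; elim/big_ind: _ => [|a b Aa Ab|i _]; last exact (AF i).
  exact (csub0 orbit_breaking_subalgebra).
exact (csubD orbit_breaking_subalgebra Aa Ab).
Qed.

Lemma orbit_breakingB a b : AY a -> AY b -> AY (a - b).
Proof.
move=> Aa Ab; rewrite -scaleN1r.
exact (csubD orbit_breaking_subalgebra Aa (csubZ orbit_breaking_subalgebra (-1) Ab)).
Qed.

Lemma star_iotau f : CX f -> star (iota f ** u) = star u ** iota (star f).
Proof. by move=> cf; rewrite starM (star_hom_star hom). Qed.

(** A version of [generated_left_invariant] with the adjoints of the generators
    written out. *)
Lemma orbit_breaking_left_invariant (V : set A) :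
  closed V -> V 0 -> (forall a b, V a -> V b -> V (a + b)) ->
  (forall (k : C) a, V a -> V (k *: a)) ->
  (forall f v, CX f -> V v -> V (iota f ** v)) ->
  (forall f v, CX f -> (forall y, Y y -> f y = 0) -> V v ->
     V (iota f ** u ** v) /\ V (star u ** iota f ** v)) ->
  forall a, AY a -> V aone -> V a.
Proof.
move=> clV V0 VD VZ Vf Vfu a Aa V1; rewrite -(amul1r a).
apply: (generated_left_invariant clV V0 VD VZ _ Aa V1).
move=> g v [[f cf <-]|[f [cf f0] <-]] Vv.
  split; first exact: Vf.
  by rewrite -(star_hom_star hom)//; apply: Vf => //; exact: contfun_star.
split; first by have [] := Vfu f v cf f0 Vv.
rewrite star_iotau//.
have [] // := Vfu (star f) v; first exact: contfun_star.
move=> y Yy; change ((f y : C)^* = 0).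
by rewrite (f0 y Yy) rmorph0.
Qed.

(** The matrices with no entries joining nonnegative indices to negative ones form
    a space which is preserved by the generators: a generator shifts the row index by at
    most one, and moves it between -1 and 0 with the weight [f y], which is zero. *)
Lemma orbmx_block a y (j k : int) : AY a -> Y y -> (0 <= j) != (0 <= k) ->
  orbmx a y j k = 0.
Proof.
move=> Aa Yy jk.
pose V := [set a | forall j k : int, (0 <= j) != (0 <= k) -> orbmx a y j k = 0].
suff : V a by move=> /(_ j k jk).
refine (orbit_breaking_left_invariant (V := V) _ _ _ _ _ _ Aa _) => {a Aa j k jk}.
- apply: closed_approx => a aV i l il.
  pose D b : C^o := orbmx b y i l.
  have clD : closed [set b | D b = 0].
    apply: (@closed_ker _ A C^o D 1) => // b.
      by move=> c; exact: orbmxB.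
    by rewrite mul1r; exact: orbmx_le.
  apply: (closed_lim clD) => e e0; have [b Vb ab] := aV e e0.
  by exists b => //; exact: Vb.
- by move=> i l _; exact: fcoef0 stdE _ _.
- by move=> a b Va Vb i l il; rewrite /orbmx (fcoefD stdE) [X in X + _]Va// [X in _ + X]Vb// addr0.
- by move=> c a Va i l il; rewrite /orbmx (fcoefZ stdE) [X in _ * X]Va// mulr0.
- by move=> f a cf Va i l il; rewrite iotaM// Va// mulr0.
- move=> f a cf f0 Va; split=> i l il; rewrite -amulA.
    rewrite iotaM// uM.
    have [->|i0] := eqVneq i 0; first by rewrite /= f0 ?mul0r.
    by rewrite Va ?mulr0//; move: il i0; lia.
  rewrite ustarM iotaM//.
  have [i0|i0] := eqVneq (i + 1) 0; first by rewrite i0 /= f0 ?mul0r.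
  by rewrite Va ?mulr0//; move: il i0; lia.
- move=> i l il; rewrite (orbmx1 h cpA stdE).
  by have -> : (i == l) = false by apply/eqP; move: il => /[swap] ->; rewrite eqxx.
Qed.

(** The block condition at the visit [y], in terms of coefficients: row [i], column
    [i - n < 0]. *)
Lemma coef_zero_pos a n (i : nat) y : AY a -> Y y -> i%:Z < n ->
  coef a n (z i y) = 0.
Proof.
move=> Aa Yy ni; have := @orbmx_block a y i (i%:Z - n) Aa Yy; rewrite /orbmx.
have -> : i%:Z - (i%:Z - n) = n by lia.
by apply; lia.
Qed.

(** The block condition at the visit [z i x]: row [-i < 0], column [-i - n >= 0]. *)
Lemma coef_zero_neg a n (i : nat) x : AY a -> Y (z i x) -> (0 < i)%N ->
  i%:Z <= - n -> coef a n x = 0.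
Proof.
move=> Aa Yy i0 ni; have := @orbmx_block a (z i x) (- i%:Z) (- i%:Z - n) Aa Yy.
rewrite /orbmx -(ziterD hK hinvK) addNr.
have -> : - i%:Z - (- i%:Z - n) = n by lia.
by apply; lia.
Qed.

Section Window.
Variables (x : X) (N : nat).
Hypotheses (Yx : Y x) (YNx : Y (z N x)).

(** Requiring the product formula for the adjoint too, and against all [b] and not
    only those in the subalgebra, makes this condition stable under all operations of a
    C*-subalgebra.  The formula for the adjoint alone is the case of the unit. *)
Let mult a := forall b (j : 'I_N) (k : int),
  orbmx (a ** b) x j k = \sum_(i < N) orbmx a x j i * orbmx b x i k /\
  orbmx (star a ** b) x j k = \sum_(i < N) (orbmx a x i j)^* * orbmx b x i k.

Let mult_star a (j k : 'I_N) : mult a -> orbmx (star a) x j k = (orbmx a x k j)^*.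
Proof.
move=> /(_ aone j k) [_]; rewrite amul1r => ->.
rewrite (bigD1 k)//= big1 ?addr0; last first.
  move=> i ni; rewrite (orbmx1 h cpA stdE) (_ : (_ == _) = false) ?mulr0//.
  by apply/negP => /eqP[] e; move: ni; rewrite (val_inj e) eqxx.
by rewrite (orbmx1 h cpA stdE) eqxx mulr1.
Qed.

Let mult_closed : closed [set a | mult a].
Proof.
apply: closed_approx => a ha b j k.
pose D1 a : C^o := orbmx (a ** b) x j k - \sum_(i < N) orbmx a x j i * orbmx b x i k.
pose D2 a : C^o := orbmx (star a ** b) x j k -
  \sum_(i < N) (orbmx a x i j)^* * orbmx b x i k.
have sle (w : A -> 'I_N -> C) c : (forall i, `|w c i| <= `|c|) ->
    `|\sum_(i < N) w c i * orbmx b x i k| <= N%:R * `|b| * `|c|.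
  move=> wc; rewrite (le_trans (ler_norm_sum _ _ _))//.
  rewrite (_ : N%:R * _ * _ = \sum_(i < N) `|b| * `|c|); last first.
    by rewrite sumr_const card_ord mulr_natl mulrnAl.
  rewrite ler_sum// => i _.
  by rewrite normrM mulrC ler_pM.
have K0 : 0 <= `|b| + N%:R * `|b| :> C by rewrite addr_ge0// mulr_ge0.
have cl1 : closed [set c | D1 c = 0].
  apply: (@closed_ker _ A C^o D1 _ K0) => [c d|c].
    rewrite /D1 amulBl orbmxB.
    have -> : \sum_(i < N) orbmx (c - d) x j i * orbmx b x i k =
      \sum_(i < N) orbmx c x j i * orbmx b x i k - \sum_(i < N) orbmx d x j i * orbmx b x i k.
      by rewrite -sumrB; apply: eq_bigr => i _; rewrite orbmxB mulrBl.
    by change (C : Type) with (C^o : Type); ring.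
  rewrite /D1 (le_trans (ler_normB _ _))// mulrDl lerD//.
    by rewrite (le_trans (orbmx_le _ _ _ _))// mulrC cstar_normM.
  by apply: (sle (fun c i => orbmx c x j i)) => i; exact: orbmx_le.
have cl2 : closed [set c | D2 c = 0].
  apply: (@closed_ker _ A C^o D2 _ K0) => [c d|c].
    rewrite /D2 starB amulBl orbmxB.
    have -> : \sum_(i < N) (orbmx (c - d) x i j)^* * orbmx b x i k =
      \sum_(i < N) (orbmx c x i j)^* * orbmx b x i k - \sum_(i < N) (orbmx d x i j)^* * orbmx b x i k.
      by rewrite -sumrB; apply: eq_bigr => i _; rewrite orbmxB rmorphB mulrBl.
    by change (C : Type) with (C^o : Type); ring.
  rewrite /D2 (le_trans (ler_normB _ _))// mulrDl lerD//.
    by rewrite (le_trans (orbmx_le _ _ _ _))// (le_trans (cstar_normM _ _))// norm_star mulrC.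
  by apply: (sle (fun c i => (orbmx c x i j)^*)) => i; rewrite norm_conjC; exact: orbmx_le.
split; apply/eqP; rewrite -subr_eq0; apply/eqP.
  apply: (closed_lim cl1) => e e0; have [c mc ac] := ha e e0.
  by exists c => //=; rewrite /D1 (mc b j k).1 subrr.
apply: (closed_lim cl2) => e e0; have [c mc ac] := ha e e0.
by exists c => //=; rewrite /D2 (mc b j k).2 subrr.
Qed.

Let orbmxD a b j k : orbmx (a + b) x j k = orbmx a x j k + orbmx b x j k.
Proof. exact: (fcoefD stdE a b (j - k) (z j x)). Qed.

Let orbmxZ c a j k : orbmx (c *: a) x j k = c * orbmx a x j k.
Proof. exact: (fcoefZ stdE c a (j - k) (z j x)). Qed.

Let orbmx0 j k : orbmx 0 x j k = 0.
Proof. exact: (fcoef0 stdE (j - k) (z j x)). Qed.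

(** For the generators, the only entries that could leave the window are the weight
    at index 0 of [f u] and the weight at index [N] of its adjoint; they are values of
    [f] at the points [x] and [h^N x] of [Y]. *)
Lemma window_multiplicative a : AY a -> mult a.
Proof.
move=> Aa; apply: (Aa [set a | mult a]); split.
  split; first exact: mult_closed.
  - move=> b j k; rewrite star0 amul0l orbmx0.
    by split; rewrite big1// => i _; rewrite orbmx0 ?rmorph0 mul0r.
  - move=> c d mc md b j k; rewrite starD !amulDl !orbmxD.
    rewrite (mc b j k).1 (mc b j k).2 (md b j k).1 (md b j k).2 -!big_split /=.
    by split; apply: eq_bigr => i _; rewrite orbmxD ?rmorphD mulrDl.
  - move=> c d md b j k; rewrite starZ !amulZl !orbmxZ.
    rewrite (md b j k).1 (md b j k).2 !mulr_sumr.
    by split; apply: eq_bigr => i _; rewrite orbmxZ ?rmorphM mulrA.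
  - move=> c d mc md b j k; rewrite starM -!amulA.
    rewrite (mc (d ** b) j k).1 (md (star c ** b) j k).2; split.
      under eq_bigr do rewrite (md _ _ _).1 mulr_sumr.
      rewrite exchange_big /=; apply: eq_bigr => i _.
      by rewrite (mc d j i).1 mulr_suml; apply: eq_bigr => l _; rewrite mulrA.
    under eq_bigr do rewrite (mc _ _ _).2 mulr_sumr.
    rewrite exchange_big /=; apply: eq_bigr => i _.
    rewrite (mc d i j).1 rmorph_sum mulr_suml; apply: eq_bigr => l _.
    by rewrite rmorphM /= mulrA [(orbmx d x l j)^* * _]mulrC.
  - move=> c mc b j k; rewrite starK (mc b j k).1 (mc b j k).2; split.
      by apply: eq_bigr => i _; rewrite mult_star.
    by apply: eq_bigr => i _; rewrite mult_star// conjCK.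
move=> g [[f cf <-]|[f [cf f0] <-]] b j k.
  rewrite -(star_hom_star hom)// !iotaM//; last exact: contfun_star.
  split.
    have -> : \sum_(i < N) orbmx (iota f) x j i * orbmx b x i k =
        \sum_(i < N) f (z j x) * (j%:Z == i%:Z)%:R * orbmx b x i k.
      apply: eq_bigr => i _; rewrite -{1}(amul1r (iota f)) iotaM//.
      by rewrite (orbmx1 h cpA stdE).
    rewrite (sum_ord_delta N j (fun=> f (z j x)) (fun i => orbmx b x i k)).
    by rewrite ifT//; have := ltn_ord j; lia.
  have -> : \sum_(i < N) (orbmx (iota f) x i j)^* * orbmx b x i k =
      \sum_(i < N) (f (z i x))^* * (j%:Z == i%:Z)%:R * orbmx b x i k.
    apply: eq_bigr => i _; rewrite -{1}(amul1r (iota f)) iotaM//.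
    by rewrite (orbmx1 h cpA stdE) rmorphM /= rmorph_nat eq_sym.
  rewrite (sum_ord_delta N j (fun i => (f (z i x))^*) (fun i => orbmx b x i k)).
  by rewrite ifT//; have := ltn_ord j; lia.
rewrite star_iotau// -!amulA iotaM// uM ustarM iotaM; last exact: contfun_star.
split.
  have -> : \sum_(i < N) orbmx (iota f ** u) x j i * orbmx b x i k =
      \sum_(i < N) f (z j x) * (j%:Z - 1 == i%:Z)%:R * orbmx b x i k.
    apply: eq_bigr => i _; rewrite -(amul1r (iota f ** u)) -amulA iotaM// uM.
    by rewrite (orbmx1 h cpA stdE).
  rewrite (sum_ord_delta N (j%:Z - 1) (fun=> f (z j x)) (fun i => orbmx b x i k)).
  case: ifP => // jN; have -> : j = 0%N :> nat by have := ltn_ord j; lia.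
  by rewrite /= f0// mul0r.
have -> : \sum_(i < N) (orbmx (iota f ** u) x i j)^* * orbmx b x i k =
    \sum_(i < N) (f (z i x))^* * (j%:Z + 1 == i%:Z)%:R * orbmx b x i k.
  apply: eq_bigr => i _; rewrite -(amul1r (iota f ** u)) -amulA iotaM// uM.
  by rewrite (orbmx1 h cpA stdE) rmorphM /= rmorph_nat subr_eq eq_sym.
rewrite (sum_ord_delta N (j%:Z + 1) (fun i => (f (z i x))^*) (fun i => orbmx b x i k)).
case: ifP => // jN.
have -> : j%:Z + 1 = N by have := ltn_ord j; lia.
change ((f (z N x))^* * orbmx b x N k = 0).
by rewrite (f0 _ YNx) rmorph0 mul0r.
Qed.

Lemma orbmx_mul a b (j k : 'I_N) : AY a ->
  orbmx (a ** b) x j k = \sum_(i < N) orbmx a x j i * orbmx b x i k.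
Proof. by move=> Aa; have [] := window_multiplicative Aa b j k. Qed.

Lemma orbmx_star a (j k : 'I_N) : AY a -> orbmx (star a) x j k = (orbmx a x k j)^*.
Proof. by move=> Aa; exact: mult_star (window_multiplicative Aa). Qed.

End Window.

(** Split [f = g s] with [g] and [s] vanishing where [f] does; then
    [f u^(n+1) = (g u) ((s o h) u^n)], and [s o h] has one fewer translate of [Y] to
    vanish on. *)
Lemma orbit_breaking_monomial f (n : nat) : CX f ->
  (forall y i, Y y -> (i < n)%N -> f (z i y) = 0) -> AY (iota f ** upow u n).
Proof.
elim: n f => [|n IH] f cf f0.
  by rewrite /= /apow /= amul1r; exact: orbit_breaking_iota.
have [g [s [cg cs fgs gs0]]] := contfun_factor cf.
have csh : CX (s \o h) by exact: contfun_comp.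
rewrite fgs (star_homM hom)//.
have -> : iota g ** iota s ** upow u n.+1 =
    (iota g ** u) ** (iota (s \o h) ** upow u n).
  have -> : n.+1%:Z = n%:Z + 1 by lia.
  rewrite (upowS (cp_uK cpA)) -!amulA; congr (_ ** _).
  rewrite !amulA (u_iota cpA)//; congr (iota _ ** _ ** _).
  by apply/funext => x /=; rewrite hinvK.
refine (csubM orbit_breaking_subalgebra _ _).
  by apply: orbit_breaking_iotau => // y Yy; case: (gs0 y (f0 y 0%N Yy _)).
apply: IH => // y i Yy ni; case: (gs0 (h (z i y))) => //.
exact: (f0 y i.+1).
Qed.

(** The adjoint of [orbit_breaking_monomial]. *)
Lemma orbit_breaking_monomialN f (n : nat) : CX f ->
  (forall x (i : nat), Y (z i x) -> (0 < i <= n)%N -> f x = 0) ->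
  AY (iota f ** upow u (- n%:Z)).
Proof.
move=> cf f0.
have cz := ziter_continuous (n := - n%:Z) h_cont hinv_cont.
have cfz : CX (star f \o z (- n%:Z)).
  by apply: contfun_comp => //; exact: contfun_star.
have -> : iota f ** upow u (- n%:Z) =
    star (iota (star f \o z (- n%:Z)) ** upow u n).
  have csf := contfun_star cf.
  rewrite starM (star_upow (cp_uV cpA) (cp_uK cpA)) -(star_hom_star hom)//.
  rewrite (upow_iota hK hinvK h_cont hinv_cont cpA); last exact: contfun_star.
  rewrite opprK; congr (iota _ ** _); apply/funext => x.
  change (f x = ((f (z (- n%:Z) (z n x)))^*)^*).
  by rewrite conjCK -(ziterD hK hinvK) addNr.
refine (csub_star orbit_breaking_subalgebra _); apply: orbit_breaking_monomial => // y i Yy ni.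
change ((f (z (- n%:Z) (z i y)))^* = 0).
rewrite (f0 _ (n - i)%N) ?rmorph0//; last by lia.
rewrite -!(ziterD hK hinvK).
by rewrite (_ : _ + _ + _ = 0)//; lia.
Qed.

End OrbitBreaking.

(** * Finite Fourier expansions *)

Lemma sum_window_shift (V : zmodType) (F : int -> V) (N : nat) :
  F (- N%:Z) = 0 -> F (N%:Z + 1) = 0 ->
  \sum_(q < N.*2.+1) F (q%:Z - N%:Z + 1) = \sum_(q < N.*2.+1) F (q%:Z - N%:Z).
Proof.
move=> F0 F1; rewrite big_ord_recr [RHS]big_ord_recl /=.
have -> : N.*2%:Z - N%:Z + 1 = N%:Z + 1 by lia.
rewrite F1 sub0r F0 addr0 add0r; apply: eq_bigr => q _.
by rewrite /bump /= add1n; congr F; lia.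
Qed.

Section Fourier.
Variables (C : numClosedFieldType) (X : topologicalType) (h hinv : X -> X).
Hypotheses (hK : cancel h hinv) (hinvK : cancel hinv h).
Hypotheses (h_cont : continuous h) (hinv_cont : continuous hinv).
Variables (A : cstarAlgType C) (iota : (X -> C^o) -> A) (u : A).
Hypothesis cpA : crossed_product hinv iota u.
Variable E : A -> X -> C^o.
Hypothesis stdE : standard_expectation iota u E.
Variable Y : set X.

Local Notation CX := (contfun C X).
Local Notation coef := (coef u E).
Local Notation AY := (orbit_breaking iota u Y).

Let hom := cp_iota cpA.
Let ccoef a n : CX (coef a n). Proof. exact: (sexp_cont stdE). Qed.

Variable N : nat.
Hypothesis band : forall a n x, AY a -> N%:Z <= `|n| -> coef a n x = 0.

Let term a n := iota (coef a n) ** upow u n.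
Let partial a := \sum_(q < N.*2.+1) term a (q%:Z - N%:Z).

Let term_band a n : AY a -> N%:Z <= `|n| -> term a n = 0.
Proof.
move=> Aa nN; rewrite /term (_ : coef a n = 0) ?(iota0 cpA) ?amul0l//.
by apply/funext => x; exact: band.
Qed.

Let termD a b n : term (a + b) n = term a n + term b n.
Proof.
rewrite /term -amulDl -(star_homD hom)//; congr (iota _ ** _).
by apply/funext => x; exact: (fcoefD stdE).
Qed.

Let termZ k a n : term (k *: a) n = k *: term a n.
Proof.
rewrite /term -amulZl -(star_homZ hom)//; congr (iota _ ** _).
by apply/funext => x; exact: (fcoefZ stdE).
Qed.

Let term_le a n : `|term a n| <= `|a|.
Proof.
have [->|a0] := eqVneq a 0.
  rewrite /term (_ : coef 0 n = 0) ?(iota0 cpA) ?amul0l//.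
  by apply/funext => x; exact: (fcoef0 stdE).
rewrite (le_trans (cstar_normM _ _))// -[leRHS]mulr1 ler_pM//; last first.
  exact: norm_upow (cp_uV cpA) (cp_uK cpA) _.
apply: (norm_hom_le hom); [exact: ccoef|by rewrite normr_gt0|].
by move=> x; exact: (coef_le cpA stdE).
Qed.

Let partialD a b : partial (a + b) = partial a + partial b.
Proof. by rewrite /partial -big_split; apply: eq_bigr => q _; exact: termD. Qed.

Let partialZ k a : partial (k *: a) = k *: partial a.
Proof. by rewrite /partial scaler_sumr; apply: eq_bigr => q _; exact: termZ. Qed.

Let V := [set a | AY a /\ partial a - a = 0].

Let V_closed : closed V.
Proof.
apply: closedI; first exact: (csub_closed (orbit_breaking_subalgebra iota u Y)).
apply: (@closed_ker _ A A (fun a => partial a - a) (N.*2.+1%:R + 1)) => //.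
- move=> a b; rewrite -scaleN1r partialD partialZ !scaleN1r.
  by rewrite !opprD addrACA.
- move=> a; rewrite (le_trans (ler_normB _ _))// mulrDl mul1r lerD//.
  rewrite (le_trans (ler_norm_sum _ _ _))//.
  rewrite (_ : _ * _ = \sum_(q < N.*2.+1) `|a|); last first.
    by rewrite sumr_const card_ord mulr_natl.
  by rewrite ler_sum.
Qed.

Let AYb := orbit_breaking_subalgebra iota u Y.

(** The elements equal to their Fourier sum over a window of degrees form a closed
    space.  Multiplication by a generator shifts the degrees by at most one, which
    moves no term across the ends of the window because the coefficients in those degrees
    vanish for all elements of the subalgebra.  Closedness rests on the contractivity of
    [iota]. *)
Lemma orbit_breaking_fourier a : AY a ->
  a = \sum_(q < N.*2.+1) iota (coef a (q%:Z - N%:Z)) ** upow u (q%:Z - N%:Z).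
Proof.
move=> Aa; suff [_ /eqP] : V a by rewrite subr_eq0 => /eqP.
have czh n b : CX (coef b n \o hinv) by exact: contfun_comp.
refine (orbit_breaking_left_invariant cpA
  (V := V) V_closed _ _ _ _ _ Aa _) => {a Aa}.
- split; first exact (csub0 AYb).
  by rewrite -(scale0r 0) partialZ !scale0r subrr.
- move=> a b [Aa Va] [Ab Vb]; split; first exact (csubD AYb Aa Ab).
  by rewrite partialD opprD addrACA Va Vb addr0.
- move=> k a [Aa Va]; split; first exact (csubZ AYb k Aa).
  by rewrite partialZ -scalerBr Va scaler0.
- move=> f a cf [Aa /eqP]; rewrite subr_eq0 => /eqP Va.
  split; first exact (csubM AYb (orbit_breaking_iota cf) Aa).
  apply/eqP; rewrite subr_eq0 -{2}Va amul_sumr; apply/eqP.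
  apply: eq_bigr => q _; rewrite /term amulA -(star_homM hom)//.
  by congr (iota _ ** _); apply/funext => x; exact: (coef_iotaM hK hinvK h_cont hinv_cont cpA stdE).
- move=> f a cf f0 [Aa /eqP]; rewrite subr_eq0 => /eqP Va.
  have Au := orbit_breaking_iotau (iota := iota) (u := u) cf f0.
  have Afua : AY (iota f ** u ** a) by exact (csubM AYb Au Aa).
  have Aufa : AY (star u ** iota f ** a).
    rewrite -[iota f]starK -starM -(star_hom_star hom)//.
    refine (csubM AYb (csub_star AYb (orbit_breaking_iotau _ _)) Aa).
      exact: contfun_star.
    by move=> y Yy; change ((f y)^* = 0); rewrite f0// rmorph0.
  split; split => //; apply/eqP; rewrite subr_eq0 -{2}Va amul_sumr; apply/eqP.
    rewrite /partial -sum_window_shift; last 2 first.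
    - by apply: term_band => //; lia.
    - by apply: term_band => //; lia.
    apply: eq_bigr => q _; set n := _ - _.
    have fuc : iota f ** u ** iota (coef a n) = iota (f ** (coef a n \o hinv)) ** u.
      by rewrite -amulA (u_iota cpA)// amulA -(star_homM hom).
    rewrite /term (upowS (cp_uK cpA)) !amulA fuc; congr (iota _ ** _ ** _).
    apply/funext => x; rewrite -amulA.
    rewrite (coef_iotaM hK hinvK h_cont hinv_cont cpA stdE)//.
    by rewrite (coef_uM hK hinvK h_cont hinv_cont cpA stdE) addrK.
  (* The adjoint of a generator lowers degrees: shift the index once to reuse
     the lemma on raising them. *)
  pose F n := term (star u ** iota f ** a) (n - 1).
  have -> : partial (star u ** iota f ** a) =
      \sum_(q < N.*2.+1) F (q%:Z - N%:Z + 1).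
    by apply: eq_bigr => q _; rewrite /F addrK.
  rewrite sum_window_shift; last 2 first.
  - by apply: term_band => //; lia.
  - by apply: term_band => //; lia.
  apply: eq_bigr => q _; set n := _ - _.
  have ufc : star u ** iota f ** iota (coef a n) =
      iota ((f ** coef a n) \o h) ** star u.
    rewrite -amulA -(star_homM hom)// (ustar_iota hinvK h_cont cpA)//.
    exact: contfunM.
  rewrite /F /term (upowB1 (cp_uV cpA) (cp_uK cpA)) !amulA ufc.
  congr (iota _ ** _ ** _).
  apply/funext => x; rewrite -amulA.
  rewrite (coef_ustarM hK hinvK h_cont hinv_cont cpA stdE).
  by rewrite (coef_iotaM hK hinvK h_cont hinv_cont cpA stdE)// subrK.
- split; first exact (@orbit_breaking1 _ _ _ _ _ _ cpA Y).
  apply/eqP; rewrite subr_eq0; apply/eqP.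
  have c1 n : coef aone n = if n == 0 then aone else 0.
    apply/funext => x.
    have -> : aone = iota aone ** upow u 0 by rewrite (star_hom1 hom) amul1l.
    rewrite (coef_mono cpA stdE); last exact: (@contfun_cst C X 1).
    by case: ifP.
  have NN : (N < N.*2.+1)%N by lia.
  rewrite /partial (bigD1 (Ordinal NN))//= big1 ?addr0 => [|q].
    by rewrite subrr /term c1 eqxx (star_hom1 hom) amul1l.
  move=> /eqP qN; rewrite /term c1 ifF ?(iota0 cpA) ?amul0l//.
  rewrite subr_eq0; apply/negP => /eqP[] qN'; apply: qN; exact: val_inj.
Qed.

End Fourier.

(** * Matrix entries and the relations of the recursive algebras *)

Section MatrixEntries.
Variable C : nmodType.

(** Natural indices with default value 0: blocks of different sizes can then be
    compared after shifting indices, without casts. *)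
Definition mx_entry N (M : 'M[C]_N) (j k : nat) : C :=
  if (insub j, insub k) is (Some a, Some b) then M a b else 0.

Lemma mx_entry_val N (M : 'M[C]_N) (j k : 'I_N) : mx_entry M j k = M j k.
Proof. by rewrite /mx_entry !valK. Qed.

Lemma mx_entry_out N (M : 'M[C]_N) j k :
  ~~ ((j < N) && (k < N))%N -> mx_entry M j k = 0.
Proof.
rewrite /mx_entry negb_and => /orP [jN|kN]; first by rewrite insubN.
have -> : insub k = None :> option 'I_N by rewrite insubN.
by case: insub.
Qed.

Lemma mx_entryP N (M M' : 'M[C]_N) :
  (forall j k, (j < N)%N -> (k < N)%N -> mx_entry M j k = mx_entry M' j k) ->
  M = M'.
Proof.
by move=> e; apply/matrixP => j k; rewrite -!mx_entry_val e.
Qed.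

Lemma mx_entry_cast N N' (e e' : N = N') (M : 'M[C]_N) j k :
  mx_entry (castmx (e, e') M) j k = mx_entry M j k.
Proof. by case: _ / e e' => e'; rewrite (eq_irrelevance e' erefl) castmx_id. Qed.

Lemma mx_entry_conform N N' (M : 'M[C]_N') j k : N' = N ->
  mx_entry (conform_mx (0 : 'M[C]_N) M) j k = mx_entry M j k.
Proof. by move=> e; case: _ / e; rewrite conform_mx_id. Qed.

Lemma mx_entry_block a d (M : 'M[C]_a) (D : 'M[C]_d) j k :
  mx_entry (block_mx M 0 0 D) j k =
  if (j < a)%N && (k < a)%N then mx_entry M j k
  else if (a <= j)%N && (a <= k)%N then mx_entry D (j - a) (k - a) else 0.
Proof.
have [jk|jk] := boolP ((j < a + d) && (k < a + d))%N; last first.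
  rewrite mx_entry_out//; case: ifP => [|_]; first by move: jk; lia.
  by case: ifP => // ?; rewrite mx_entry_out//; move: jk; lia.
case/andP: jk => jN kN.
rewrite -[j in LHS]/(val (Ordinal jN)) -[k in LHS]/(val (Ordinal kN)) mx_entry_val.
case: (splitP (Ordinal jN)) (@splitK a d (Ordinal jN)) => j' /= ej _.
  have -> : Ordinal jN = lshift d j' by exact: val_inj.
  case: (splitP (Ordinal kN)) => k' /= ek.
    have -> : Ordinal kN = lshift d k' by exact: val_inj.
    by rewrite block_mxEul ej ek mx_entry_val.
  have -> : Ordinal kN = rshift a k' by exact: val_inj.
  by rewrite block_mxEur mxE; case: ifP => //; have := ltn_ord j'; lia.
have -> : Ordinal jN = rshift a j' by exact: val_inj.
case: (splitP (Ordinal kN)) => k' /= ek.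
  have -> : Ordinal kN = lshift d k' by exact: val_inj.
  by rewrite block_mxEdl mxE; case: ifP => //; have := ltn_ord k'; lia.
have -> : Ordinal kN = rshift a k' by exact: val_inj.
rewrite block_mxEdr ifT; last by lia.
by rewrite ej ek !addKn mx_entry_val.
Qed.

Fixpoint diag_entry n (q : nat -> nat) (e : nat -> nat -> nat -> C) (j k : nat) : C :=
  if n is n'.+1 then
    if (j < q 0 )%N && (k < q 0)%N then e 0 j k
    else if (q 0 <= j)%N && (q 0 <= k)%N then
      diag_entry n' (fun s => q s.+1) (fun s => e s.+1) (j - q 0) (k - q 0)
    else 0
  else 0.

Lemma mxdiag_entry n (p : 'I_n -> nat) (B : forall s, 'M[C]_(p s))
    (q : nat -> nat) (e : nat -> nat -> nat -> C) j k :
  (forall s, p s = q s) -> (forall s j k, mx_entry (B s) j k = e s j k) ->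
  mx_entry (mxdiag B) j k = diag_entry n q e j k.
Proof.
elim: n p B q e j k => [|n IH] p B q e j k pq Be.
  by rewrite mx_entry_out// !big_ord0.
rewrite mxdiag_recl mx_entry_cast mx_entry_block /= -(pq ord0) Be.
case: ifP => // _; case: ifP => // _.
by apply: IH => [s|s j' k']; [exact: pq|exact: Be].
Qed.

End MatrixEntries.

Section RawEntries.
Variables (X : topologicalType) (h : X -> X) (T : nat -> set X) (r : nat -> nat).
Variable C : numClosedFieldType.
Local Notation dsumT n := (dsum C (fun i => T i) r n).

(** The block diagonal matrix for the sequence [nu] at [x], each block being read at
    the point of the orbit where the previous one ends: [beta_(l, mu)] without its
    dependent types. *)
Fixpoint block_entry (e : nat -> X -> nat -> nat -> C) (nu : seq nat)
    (x : X) (j k : nat) : C :=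
  if nu is i :: nu' then
    if (j < r i)%N && (k < r i)%N then e i x j k
    else if (r i <= j)%N && (r i <= k)%N then
      block_entry e nu' (iter (r i) h x) (j - r i) (k - r i)
    else 0
  else 0.

(** Membership in [T_(l, mu)], read along the orbit. *)
Fixpoint chain (nu : seq nat) (x : X) : Prop :=
  if nu is i :: nu' then T i x /\ chain nu' (iter (r i) h x) else True.

Definition height (nu : seq nat) : nat := sumn (map r nu).

Lemma chainP nu x : chain nu x <->
  forall s, (s < size nu)%N ->
    T (nth 0%N nu s) (iter (height (take s nu)) h x).
Proof.
elim: nu x => [|i nu IH] x /=; first by split=> // _ [].
rewrite IH; split=> [[Tx ch] [|s] sn //=|ch].
  by rewrite /height /= addnC iterD; exact: ch.
split; first exact: (ch 0%N).
by move=> s sn; have := ch s.+1 sn; rewrite /height /= addnC iterD.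
Qed.

Lemma block_entry_diag e nu x j k :
  block_entry e nu x j k =
  diag_entry (size nu) (fun s => r (nth 0%N nu s))
    (fun s => e (nth 0%N nu s) (iter (height (take s nu)) h x)) j k.
Proof.
elim: nu x j k => [//|i nu IH] x j k /=.
case: ifP => // _; case: ifP => // _; rewrite IH; congr diag_entry.
by apply/funext => s; rewrite /height /= addnC iterD.
Qed.

Lemma eq_block_entry e e' nu x j k :
  (forall i, i \in nu -> forall y a b, e i y a b = e' i y a b) ->
  block_entry e nu x j k = block_entry e' nu x j k.
Proof.
elim: nu x j k => [//|i nu IH] x j k ee /=; rewrite ee ?mem_head// IH//.
by move=> i' ni'; apply: ee; rewrite in_cons ni' orbT.
Qed.

(** Only natural indices and points of [X] occur here, with value 0 out of range, so
    that components of different sizes over different sets can be compared. *)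
Definition entry n (b : dsumT n) (i : nat) (x : X) (j k : nat) : C :=
  if insub i is Some o then mx_entry (eval_at (b o) x) j k else 0.

Lemma eval_at_val (S : set X) N (f : S -> 'M[C]_N) (x : S) :
  eval_at f (set_val x) = f x.
Proof. by rewrite /eval_at valK. Qed.

Lemma entry_ord n (b : dsumT n) (i : 'I_n) x j k :
  entry b i x j k = mx_entry (eval_at (b i) x) j k.
Proof. by rewrite /entry valK. Qed.

Lemma entry_val n (b : dsumT n) (i : 'I_n) (x : T i) (j k : 'I_(r i)) :
  entry b i (set_val x) j k = b i x j k.
Proof. by rewrite entry_ord eval_at_val mx_entry_val. Qed.

Lemma entry_init n (b : dsumT n.+1) i x j k : (i < n)%N ->
  entry (dsum_init b) i x j k = entry b i x j k.
Proof.
move=> ni; have ni' : (i < n.+1)%N by lia.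
rewrite -[i in LHS]/(val (Ordinal ni)) -[i in RHS]/(val (Ordinal ni')) !entry_ord.
pose G (o : 'I_n.+1) := mx_entry (eval_at (b o) x) j k.
change (G (widen_ord (leqnSn n) (Ordinal ni)) = G (Ordinal ni')).
by congr G; exact: val_inj.
Qed.

Lemma entryP n (b b' : dsumT n) :
  (forall (i : 'I_n) x j k, T i x -> (j < r i)%N -> (k < r i)%N ->
    entry b i x j k = entry b' i x j k) -> b = b'.
Proof.
move=> ee; apply: functional_extensionality_dep => i; apply/funext => x.
apply/matrixP => j k; rewrite -!entry_val; apply: ee => //.
exact: set_valP.
Qed.

Lemma ordseq_lift l (nu : seq nat) : all (fun i => (i < l)%N) nu ->
  exists mu : seq 'I_l, map val mu = nu.
Proof.
elim: nu => [|i nu IH] /=; first by exists [::].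
by case/andP => il /IH [mu <-]; exists (Ordinal il :: mu).
Qed.

Lemma height_val l (mu : seq 'I_l) : height (map val mu) = (\sum_(i <- mu) r i)%N.
Proof. by rewrite /height -map_comp sumnE big_map. Qed.

Lemma TmuP l (mu : seq 'I_l) (x : T l) :
  Tmu h r mu x <-> chain (map val mu) (set_val x).
Proof.
have nthE (s : 'I_(size mu)) :
    nth 0%N (map val mu) s = val (tnth (in_tuple mu) s).
  pose d := tnth (in_tuple mu) s.
  by rewrite (nth_map d) ?ltn_ord// (tnth_nth d).
rewrite chainP size_map; split=> [Tx s sn|ch s].
  have := Tx (Ordinal sn); rewrite -nthE /= /offset.
  by rewrite -map_take height_val.
by have := ch s (ltn_ord s); rewrite nthE -map_take height_val.
Qed.

Lemma beta_mu_entry l (mu : seq 'I_l) (b : dsumT l) (x : Tmu h r mu) j k :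
  admissible r mu ->
  mx_entry (beta_mu b x) j k =
  block_entry (entry b) (map val mu) (set_val (set_val x)) j k.
Proof.
move=> adm; rewrite /beta_mu mx_entry_conform; last first.
  by rewrite -adm [RHS]big_tnth.
have nthE (s : 'I_(size mu)) :
    nth 0%N (map val mu) s = val (tnth (in_tuple mu) s).
  pose d := tnth (in_tuple mu) s.
  by rewrite (nth_map d) ?ltn_ord// (tnth_nth d).
rewrite block_entry_diag size_map; apply: mxdiag_entry => [s|s j' k'].
  by rewrite nthE.
by rewrite nthE entry_ord /offset -map_take height_val.
Qed.

(** The recursive definition of [R_l] flattened: all relations are imposed on the
    entries of the one family [b], since a sequence admissible for [i] involves only
    components of index below [i]. *)
Lemma RalgP l (b : dsumT l.+1) : (0 < r 0)%N ->
  Ralg h T r C l b <->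
  (forall i : 'I_l.+1, contmx C (T i) (r i) (b i)) /\
  (forall i nu x j k, (i <= l)%N -> all (fun e => (e < i)%N) nu ->
     height nu = r i -> T i x -> chain nu x -> (j < r i)%N -> (k < r i)%N ->
     entry b i x j k = block_entry (entry b) nu x j k).
Proof.
move=> r0; elim: l b => [|l IH] b.
  split=> [/= cb|[cb _]]; last exact: (cb ord0).
  split; first by move=> i; rewrite (ord1 i).
  move=> i [|e nu] x j k; rewrite leqn0 => /eqP -> //.
  by move=> _ h0; move: r0; rewrite -h0.
have blkE i nu x j k : (i <= l.+1)%N -> all (fun e => (e < i)%N) nu ->
    block_entry (entry (dsum_init b)) nu x j k = block_entry (entry b) nu x j k.
  move=> il /allP nui; apply: eq_block_entry => e /nui ei y j' k'.
  by apply: entry_init; lia.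
have entE : forall (x : T l.+1) (j k : 'I_(r l.+1)),
   b ord_max x j k = entry b l.+1 (set_val x) j k.
  by move=> x j k; rewrite -(@entry_val _ b ord_max x j k).
split=> [[/IH [cb rb] cl rl]|[cb rb]].
  split=> [i|i nu x j k].
    case: (unliftP ord_max i) => [i' ->|->//].
    have -> : lift ord_max i' = widen_ord (leqnSn l.+1) i'.
      by apply: val_inj; rewrite /= /bump leqNgt ltn_ord.
    exact: cb.
  rewrite leq_eqVlt => /orP [/eqP ->|il]; last first.
    move=> nui hnu Tx ch jr kr.
    by rewrite -(entry_init b)// (rb _ nu)// (blkE i)//; lia.
  move=> nui hnu Tx ch jr kr; have [mu emu] := ordseq_lift nui.
  have adm : admissible r mu by rewrite /admissible /= -height_val emu.
  pose x1 : T l.+1 := SigSub (mem_set Tx).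
  have Tx1 : Tmu h r mu x1 by apply/TmuP; rewrite emu.
  pose x2 : Tmu h r mu := SigSub (mem_set Tx1).
  have := congr1 (fun M => mx_entry M j k) (rl mu adm x2).
  rewrite beta_mu_entry// emu (blkE l.+1)//= => <-.
  have := entE x1 (Ordinal jr) (Ordinal kr).
  by rewrite -mx_entry_val => ->.
split.
- apply/IH; split=> [i|i nu x j k il nui hnu Tx ch jr kr].
    exact: (cb (widen_ord (leqnSn l.+1) i)).
  by rewrite entry_init// (rb _ nu)//; [rewrite (blkE i)//; lia|lia].
- exact: (cb ord_max).
- move=> mu adm x; apply: mx_entryP => j k jr kr.
  have mul : all (fun e => (e < l.+1)%N) (map val mu).
    by apply/allP => _ /mapP [e _ ->]; exact: ltn_ord.
  rewrite beta_mu_entry// (blkE l.+1)// -(rb l.+1)//; last 3 first.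
  - by rewrite height_val.
  - exact: set_valP.
  - by apply/TmuP; exact: set_valP.
  by rewrite -(entE (set_val x) (Ordinal jr) (Ordinal kr)) -mx_entry_val.
Qed.

End RawEntries.

(** * Return times and canonical entries *)

Section LastReturn.
Variables (X : topologicalType) (h : X -> X) (Y : set X).
Implicit Types (x : X) (p q : nat).

Lemma first_returnP y s : first_return h Y y = Some s ->
  [/\ (0 < s)%N, Y (iter s h y) &
    forall p, (0 < p < s)%N -> ~ Y (iter p h y)].
Proof.
rewrite /first_return; case: pselect => // e [<-].
case: ex_minnP => n /andP[n0 /asboolP Yn] nmin; split=> // p /andP[p0 pn] Yp.
by have := nmin p; rewrite p0 /=; move=> /(_ (asboolT Yp)); lia.
Qed.

(** The default 0 is harmless: the base points of interest are in [Y], so that 0 is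
    itself a visit. *)
Fixpoint last_return x q : nat :=
  if q is q'.+1 then
    if `[< Y (iter q h x) >] then q else last_return x q'
  else 0.

Lemma last_return_le x q : (last_return x q <= q)%N.
Proof. by elim: q => //= q IH; case: ifP => // _; lia. Qed.

Lemma last_return_in x q : Y x -> Y (iter (last_return x q) h x).
Proof. by move=> Yx; elim: q => //= q IH; case: asboolP. Qed.

Lemma last_return_max x q p : (last_return x q < p <= q)%N -> ~ Y (iter p h x).
Proof.
elim: q => [|q IH] /=; first by lia.
case: asboolP => [_|nY]; first by lia.
rewrite [(p <= _)%N]leq_eqVlt => /andP[lp /orP [/eqP ->//|pq]].
by apply: IH; rewrite lp.
Qed.

Lemma last_return_unique x q a : Y x -> (a <= q)%N -> Y (iter a h x) ->
  (forall p, (a < p <= q)%N -> ~ Y (iter p h x)) -> last_return x q = a.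
Proof.
move=> Yx aq Ya amax; apply/eqP; rewrite eqn_leq; apply/andP; split.
  rewrite leqNgt; apply/negP => al; apply: (amax (last_return x q)).
    by rewrite al last_return_le.
  exact: last_return_in.
rewrite leqNgt; apply/negP => la; apply: (@last_return_max x q a) => //.
by rewrite la.
Qed.

Lemma last_return_shift x q p : Y x -> (p <= q)%N -> Y (iter p h x) ->
  last_return x q = (p + last_return (iter p h x) (q - p))%N.
Proof.
move=> Yx pq Yp; apply: last_return_unique => //.
- by have := last_return_le (iter p h x) (q - p); lia.
- by rewrite addnC iterD; exact: last_return_in.
- move=> p' p'q; have -> : p' = ((p' - p) + p)%N by lia.
  by rewrite iterD; apply: (@last_return_max _ (q - p)); lia.
Qed.

End LastReturn.

Section Canonical.
Variables (X : topologicalType) (h : X -> X).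
Variables (Y : set X) (m : nat) (T : nat -> set X) (r : nat -> nat).
Hypothesis rok : rokhlin_system h Y m T r.
Local Notation last := (last_return h Y).

Lemma T_sub_Y i x : (i <= m)%N -> T i x -> Y x.
Proof. by move=> im; exact: (rok_sub rok im). Qed.

Lemma r_gt0 i : (i <= m)%N -> (0 < r i)%N.
Proof. by move=> im; exact: (rok_pos rok im). Qed.

Lemma r_mono i j : (i <= j)%N -> (j <= m)%N -> (r i <= r j)%N.
Proof.
elim: j => [|j IH]; first by rewrite leqn0 => /eqP ->.
rewrite leq_eqVlt => /orP [/eqP ->//|ij] jm.
by apply: leq_trans (IH _ _) (rok_mono rok jm); lia.
Qed.

Lemma T_return i x : (i <= m)%N -> T i x -> Y (iter (r i) h x).
Proof. by move=> im Tx; apply: (rok_into rok im); exists x. Qed.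

(** The least [i] with [x] in [T_i], that is, the [i] for which [x] is in [T_i^0]; so
    [r] of it is the first return time of [x]. *)
Definition base_index x : nat := find (fun i => `[< T i x >]) (iota 0 m.+1).

Lemma base_indexP x : Y x -> [/\ (base_index x <= m)%N, T (base_index x) x,
    forall i, T i x -> (i <= m)%N -> (base_index x <= i)%N &
    forall p, (0 < p < r (base_index x))%N -> ~ Y (iter p h x)].
Proof.
move=> Yx; have [i im Tx] : (\bigcup_(l in [set l | (l <= m)%N]) T l) x.
  by rewrite -(rok_cover rok).
have hT : has (fun i => `[< T i x >]) (iota 0 m.+1).
  by apply/hasP; exists i; [rewrite mem_iota /=; move: im => /=; lia|exact/asboolP].
have ti : (base_index x <= m)%N.
  by move: hT; rewrite has_find size_iota ltnS.
have tT : T (base_index x) x.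
  by have := nth_find 0 hT => /asboolP; rewrite nth_iota.
have tmin j : T j x -> (j <= m)%N -> (base_index x <= j)%N.
  move=> Tj jm; rewrite leqNgt; apply/negP => jt.
  have := before_find 0 jt; rewrite nth_iota ?add0n; last by lia.
  by move/negP; apply; exact/asboolP.
split=> //; suff /first_returnP[] : first_return h Y x = Some (r (base_index x)) by [].
apply: (rok_return rok ti); split=> // -[_ [j jt Tj]].
by have := tmin j Tj; move: jt => /=; lia.
Qed.

Lemma base_index_first_return x p : Y x -> (0 < p)%N -> Y (iter p h x) ->
  (r (base_index x) <= p)%N.
Proof.
move=> Yx p0 Yp; have [_ _ _ nr] := base_indexP Yx.
by rewrite leqNgt; apply/negP => pr; apply: (nr p); rewrite ?p0.
Qed.

(** Jump from one visit to the next: the height of the jump from a point of [Y] is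
    the first return time, so the jumps meet every visit, in particular the one at time
    [n]. *)
Lemma return_chain n x : Y x -> Y (iter n h x) -> exists nu,
  [/\ height r nu = n, chain h T r nu x &
      all (fun e => (e <= m)%N && (r e <= n)%N) nu].
Proof.
elim/ltn_ind: n x => -[|n] IH x Yx Yn; first by exists [::].
have [ti tT _ _] := base_indexP Yx.
have rn := base_index_first_return Yx (ltn0Sn n) Yn.
have r0 := r_gt0 ti.
have Yr := T_return ti tT.
have [||nu [hnu ch al]] := IH (n.+1 - r (base_index x))%N _ _ Yr.
- by lia.
- by rewrite -iterD subnK.
exists (base_index x :: nu); split=> /=.
- by rewrite /height /= -/(height r nu) hnu; lia.
- by [].
- by rewrite ti rn; apply: sub_all al => e; lia.
Qed.

(** This is [D_i = \bigcup_mu T_(i, mu)].  If [x] also lies in some [T_j] with [j < i],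
    then the jump chain from time 0 to time [r_i] uses only indices below [i]: the
    first by hypothesis, the others because their heights add up to less than [r_i]. *)
Lemma overlap_chain i x : (i <= m)%N -> T i x -> (base_index x < i)%N -> exists nu,
  [/\ all (fun e => (e < i)%N) nu, height r nu = r i & chain h T r nu x].
Proof.
move=> im Tx xi; have Yx := T_sub_Y im Tx; have [ti tT _ _] := base_indexP Yx.
have rr := r_mono (ltnW xi) im; have r0 := r_gt0 ti.
have [||nu [hnu ch al]] := @return_chain (r i - r (base_index x))%N (iter (r (base_index x)) h x).
- exact: T_return.
- by rewrite -iterD subnK//; exact: T_return.
exists (base_index x :: nu); split=> //=.
- rewrite xi; apply: sub_all al => e /andP[em re].
  by rewrite ltnNge; apply/negP => ie; have := r_mono ie em; lia.
- by rewrite /height /= -/(height r nu) hnu; lia.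
Qed.

Section CanonicalEntry.
Variable C : nmodType.
Implicit Type e : nat -> X -> nat -> nat -> C.

(** The entry that a block diagonal matrix cut at all the visits to [Y] must have:
    zero if a visit separates [j] from [k], and otherwise the entry of the block based at
    the last visit before both. *)
Definition canonical_entry e x j k : C :=
  let p := last x j in
  if last x k == p then e (base_index (iter p h x)) (iter p h x) (j - p)%N (k - p)%N
  else 0.

Lemma canonical_entry_shift e x p j k : Y x -> Y (iter p h x) -> (p <= j)%N -> (p <= k)%N ->
  canonical_entry e x j k = canonical_entry e (iter p h x) (j - p) (k - p).
Proof.
move=> Yx Yp pj pk; rewrite /canonical_entry.
rewrite (last_return_shift Yx pj Yp) (last_return_shift Yx pk Yp) eqn_add2l.
case: ifP => // _; set q := last _ _; rewrite !subnDA.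
by have -> : iter (p + q) h x = iter q h (iter p h x) by rewrite addnC iterD.
Qed.

Lemma canonical_entry_cut e x p j k : Y (iter p h x) ->
  (k < p <= j)%N || (j < p <= k)%N -> canonical_entry e x j k = 0.
Proof.
move=> Yp jk; rewrite /canonical_entry; case: eqP => // ejk.
exfalso; have := last_return_le h Y x j; have := last_return_le h Y x k.
rewrite ejk => lk lj; case/orP: jk => pjk.
  by apply: (@last_return_max _ h Y x j p) => //; lia.
by apply: (@last_return_max _ h Y x k p) => //; lia.
Qed.

Lemma canonical_entry_base e x j k : Y x -> (j < r (base_index x))%N -> (k < r (base_index x))%N ->
  canonical_entry e x j k = e (base_index x) x j k.
Proof.
move=> Yx jr kr; have [_ _ _ nr] := base_indexP Yx.
have l0 q : (q < r (base_index x))%N -> last x q = 0%N.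
  by move=> qr; apply: last_return_unique => // p pq; apply: nr; lia.
by rewrite /canonical_entry !l0//= !subn0.
Qed.

End CanonicalEntry.

Variable C : numClosedFieldType.

(** Over the overlap of [T_i] with the earlier sets, a relation of [R_l] replaces the
    matrix by blocks of smaller index; by induction on [i] these are canonical, and a
    block diagonal matrix with canonical blocks cut at visits is canonical. *)
Lemma Ralg_canonical l (b : dsum C (fun i => T i) r l.+1) i x j k :
  (l <= m)%N -> Ralg h T r C l b -> (i <= l)%N -> T i x ->
  (j < r i)%N -> (k < r i)%N -> entry b i x j k = canonical_entry (entry b) x j k.
Proof.
move=> lm /(RalgP h _ (r_gt0 (leq0n m))) [_ rel].
elim/ltn_ind: i x j k => i IH x j k il Tx jr kr.
have im : (i <= m)%N by lia.
have Yx := T_sub_Y im Tx; have [ti tT tmin _] := base_indexP Yx.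
have := tmin i Tx im; rewrite leq_eqVlt => /orP [/eqP ti'|ti'].
  by rewrite canonical_entry_base// ti'.
have [nu [nui hnu ch]] := overlap_chain im Tx ti'.
rewrite (rel i nu)// => {rel}; move: jr kr; rewrite -hnu => {Tx tT tmin ti ti' hnu}.
elim: nu x j k Yx nui ch => [//|e nu IHnu] x j k Yx /= /andP[ei nui] [Te ch].
have em : (e <= m)%N by lia.
have Yr := T_return em Te.
rewrite /height /= -/(height r nu) => jr kr.
case: ifP => [/andP[je ke]|jke]; first by apply: IH => //; lia.
case: ifP => [/andP[je ke]|jke'].
  by rewrite (canonical_entry_shift _ Yx Yr)// IHnu//; lia.
by rewrite (canonical_entry_cut _ Yr)//; lia.
Qed.

End Canonical.

(** * Rokhlin towers *)

Lemma iter_cancel (X : Type) (h hinv : X -> X) p j x : cancel hinv h ->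
  (p <= j)%N -> iter p h (iter j hinv x) = iter (j - p) hinv x.
Proof.
move=> hinvK; elim: p j => [|p IH] j pj; first by rewrite subn0.
case: j pj => // j pj; rewrite iterSr /= hinvK IH//.
Qed.

Section Towers.
Variables (X : topologicalType) (h hinv : X -> X).
Hypotheses (hK : cancel h hinv) (hinvK : cancel hinv h) (h_cont : continuous h).
Variables (Y : set X) (m : nat) (T : nat -> set X) (r : nat -> nat).
Hypothesis rok : rokhlin_system h Y m T r.
Hypotheses (X_hausdorff : hausdorff_space X) (Y_compact : compact Y).
Hypothesis Y_closure :
  Y `<=` closure (\bigcup_(n in [set n | (0 < n)%N]) (iter n h @` Y)).

(** A point [h^n y] of the forward orbit of [Y] was in [Y] at most [r_m] steps
    before, by the bound on first return times.  So [Y] lies in the closure of a finite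
    union of translates, which is compact. *)
Lemma backward_return y : Y y ->
  exists2 q, (0 < q)%N & Y (iter q hinv y).
Proof.
pose B := \bigcup_(q in [set q | (0 < q <= r m)%N]) (iter q h @` Y).
have clB : closed B.
  apply: closed_bigcup => [|q _].
    by apply: (sub_finite_set _ (finite_II (r m).+1)) => q /=; lia.
  apply: compact_closed => //; apply: continuous_compact => //.
  apply: continuous_subspaceT.
  exact: (@ziter_continuous X h h q h_cont h_cont).
have UB : \bigcup_(n in [set n | (0 < n)%N]) (iter n h @` Y) `<=` B.
  move=> _ [n /= n0 [x Yx <-]].
  set p := last_return h Y x n.-1.
  have Yp : Y (iter p h x) := last_return_in h n.-1 Yx.
  have [ti tT _ _] := base_indexP rok Yp.
  have pn : (p <= n.-1)%N := last_return_le h Y x n.-1.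
  have Yr := T_return rok ti tT.
  exists (n - p)%N => /=; last first.
    by exists (iter p h x) => //; rewrite -iterD subnK//; lia.
  apply/andP; split; first by lia.
  apply: leq_trans (r_mono rok ti (leqnn m)).
  rewrite leqNgt; apply/negP => rnp.
  have := r_gt0 rok ti => r0.
  apply: (@last_return_max _ h Y x n.-1 (r (base_index m T (iter p h x)) + p)).
    by rewrite -/p; lia.
  by rewrite iterD.
move=> /Y_closure /(closure_subset UB); rewrite -(closure_id _).1//.
move=> [q /= /andP[q0 _] [x Yx <-]]; exists q => //.
by rewrite (iter_cancel _ hK)// subnn.
Qed.

Lemma backward_return_ge n y : Y y ->
  exists2 j, (n <= j)%N & Y (iter j hinv y).
Proof.
elim: n y => [|n IH] y Yy; first by exists 0%N.
have [q q0 Yq] := backward_return Yy; have [j nj Yj] := IH _ Yq.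
by exists (j + q)%N; [lia|rewrite iterD].
Qed.

Hypothesis orbits : \bigcup_(n in [set: int]) (ziter h hinv n @` Y) = [set: X].

(** Go back from [x] to its last visit [y] to [Y], at time [-j].  The orbit of [y] does
    not meet [Y] at the times 1 to [j], so [j] is less than the first return time of
    [y]. *)
Lemma tower_cover x : exists y j,
  [/\ Y y, (j < r (base_index m T y))%N & iter j h y = x].
Proof.
have [j0 Yj0] : exists j, Y (iter j hinv x).
  have : [set: X] x by []; rewrite -orbits => -[[n|n] _ [y Yy <-]] /=.
    by exists n; rewrite (iter_cancel _ hK)// subnn.
  have [j nj Yj] := backward_return_ge n.+1 Yy.
  by exists (j - n.+1)%N; rewrite -[hinv _]/(iter n.+1 hinv y) -iterD subnK.
have exj : exists j, `[< Y (iter j hinv x) >] by exists j0; apply/asboolP.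
case: (ex_minnP exj) => j /asboolP Yj jmin.
exists (iter j hinv x), j; split=> //; last first.
  by rewrite (iter_cancel _ hinvK)// subnn.
have [ti tT _ _] := base_indexP rok Yj.
rewrite ltnNge; apply/negP => rj; have r0 := r_gt0 rok ti.
have := T_return rok ti tT; rewrite (iter_cancel _ hinvK)// => Yr.
by have := jmin _ (asboolT Yr); lia.
Qed.

End Towers.

(** * Extension and gluing of continuous functions *)

Section MatrixContinuity.
Variables (C : numClosedFieldType) (Z : topologicalType) (N : nat).

Lemma continuous_mx (f : Z -> 'M[C]_N) :
  (forall i j, continuous (fun x => f x i j : C^o)) -> continuous f.
Proof.
move=> cf x B [P nP PB].
have nQ i j : nbhs x [set y | P i j (f y i j)] by apply: (cf i j x); exact: nP.
have := filter_forall (nbhs_filter x) (fun i => filter_forall (nbhs_filter x) (nQ i)).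
by apply: filterS => y Py; apply: PB => i j; exact: Py.
Qed.

Lemma mx_entry_continuous (f : Z -> 'M[C]_N) j k : continuous f ->
  continuous (fun x => mx_entry (f x) j k : C^o).
Proof.
move=> cf; have [/andP[jN kN]|jk] := boolP ((j < N) && (k < N))%N; last first.
  rewrite (_ : (fun x => _) = fun=> 0); first by move=> x; exact: cvg_cst.
  by apply/funext => x; rewrite mx_entry_out.
rewrite (_ : (fun x => _) = (fun M : 'M[C]_N => M (Ordinal jN) (Ordinal kN) : C^o) \o f).
  by move=> x; apply: continuous_comp; [exact: cf|exact: coord_continuous].
by apply/funext => x; rewrite /= -mx_entry_val.
Qed.

End MatrixContinuity.

Section ComplexTietze.
Variables (R : realType) (X : topologicalType).
Hypotheses (X_normal : normal_space X) (X_compact : compact [set: X]).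
Local Notation C := (R[i]).
Implicit Types (F G g : X -> C^o).

Let nonexpansive_real (f : C^o -> R^o) :
  (forall a b : C, (`|f a - f b|%:C <= `|a - b|)%C) -> continuous f.
Proof.
move=> hf x B /nbhs_ballP [e /= e0 eB]; apply/nbhs_ballP; exists (e%:C)%C.
  by rewrite /= ltcR.
move=> y; rewrite -ball_normE /= => xy; apply: eB; rewrite -ball_normE /=.
by rewrite -ltcR (le_lt_trans (hf _ _)).
Qed.

Lemma continuous_Re : continuous (fun a : C^o => complex.Re a : R^o).
Proof.
apply: nonexpansive_real => -[a a'] [b b'] /=.
rewrite normc_def lecR /= -sqrtr_sqr ler_wsqrtr// lerDl sqr_ge0//.
Qed.

Lemma continuous_Im : continuous (fun a : C^o => complex.Im a : R^o).
Proof.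
apply: nonexpansive_real => -[a a'] [b b'] /=.
rewrite normc_def lecR /= -sqrtr_sqr ler_wsqrtr// lerDr sqr_ge0//.
Qed.

Lemma continuous_real_complex : continuous (fun a : R^o => (a%:C)%C : C^o).
Proof.
move=> x B /nbhs_ballP [e /= e0 eB]; apply/nbhs_ballP; exists (complex.Re e).
  by move: e0; rewrite ltcE => /andP[].
move=> y; rewrite -ball_normE /= => xy; apply: eB; rewrite -ball_normE /=.
rewrite -rmorphB normc_def /= expr0n /= addr0 sqrtr_sqr.
by move: e0 xy; rewrite !ltcE /= => /andP[/eqP -> _] ->; rewrite eqxx.
Qed.

(** Tietze's theorem for the real and the imaginary part; these are bounded because
    [K] is compact. *)
Lemma complex_tietze (K : set X) F : closed K -> {within K, continuous F} ->
  exists G, continuous G /\ forall x, K x -> G x = F x.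
Proof.
move=> clK cF.
have cK : compact K := subclosed_compact clK X_compact (@subsetT _ K).
have ext (p : C^o -> R^o) : continuous p ->
    exists g : X -> R^o, continuous g /\ forall x, K x -> g x = p (F x).
  move=> cp; have cpF : {within K, continuous (p \o F)}.
    by apply: within_continuous_comp cF => x _; exact: cp.
  have /pinfty_ex_gt0 [M M0 hM] := compact_bounded (continuous_compact cpF cK).
  have [|g [gE cg _]] := continuous_bounded_extension X_normal clK M0 cpF.
    by move=> x Kx; apply: hM; exists x.
  by exists g; split=> // x Kx; rewrite -gE ?inE.
have [g [cg gE]] := ext _ continuous_Re.
have [g' [cg' gE']] := ext _ continuous_Im.
exists (fun x => ((g x)%:C + 'i * (g' x)%:C)%C : C^o); split; last first.
  by move=> x Kx; rewrite gE// gE'// -complexE.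
move=> x; apply: cvgD.
  by apply: (continuous_comp (cg x)); exact: continuous_real_complex.
apply: cvgM; first exact: cvg_cst.
by apply: (continuous_comp (cg' x)); exact: continuous_real_complex.
Qed.

(** The function equal to [g] on [P] and to [G] elsewhere is continuous on the union of
    the two closed sets. *)
Lemma glue_two (K P : set X) G g : closed K -> closed P ->
  continuous G -> continuous g -> (forall x, K x -> P x -> G x = g x) ->
  exists G', [/\ continuous G', forall x, K x -> G' x = G x &
    forall x, P x -> G' x = g x].
Proof.
move=> clK clP cG cg Gg.
pose F : X -> C^o := fun x => if `[< P x >] then g x else G x.
have FG x : K x -> F x = G x by rewrite /F; case: asboolP => // Px Kx; rewrite Gg.
have Fg x : P x -> F x = g x by rewrite /F; case: asboolP.
have cFK : {within K, continuous F}.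
  refine (@subspace_eq_continuous X K C^o G F _ (continuous_subspaceT cG)).
  by move=> x /set_mem Kx; exact/esym/FG.
have cFP : {within P, continuous F}.
  refine (@subspace_eq_continuous X P C^o g F _ (continuous_subspaceT cg)).
  by move=> x /set_mem Px; exact/esym/Fg.
have cF := withinU_continuous clK clP cFK cFP.
have [G' [cG' G'F]] := complex_tietze (closedU clK clP) cF.
exists G'; split=> // x Hx; first by rewrite G'F ?FG//; left.
by rewrite G'F ?Fg//; right.
Qed.

Lemma glue_finite (I : eqType) (s : seq I) (P : I -> set X) (g : I -> X -> C^o) :
  (forall i, i \in s -> closed (P i)) -> (forall i, i \in s -> continuous (g i)) ->
  (forall i j x, i \in s -> j \in s -> P i x -> P j x -> g i x = g j x) ->
  exists G, continuous G /\ forall i x, i \in s -> P i x -> G x = g i x.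
Proof.
move=> clP cg con.
pose K (t : seq I) := [set x | exists2 i, i \in t & P i x].
have clK (t : seq I) : {subset t <= s} -> closed (K t).
  elim: t => [|i t IH] ts.
    by rewrite (_ : K [::] = set0); [exact: closed0|rewrite -subset0 => x []].
  rewrite (_ : K (i :: t) = P i `|` K t).
    apply: closedU; first by apply: clP; apply: ts; exact: mem_head.
    by apply: IH => j jt; apply: ts; rewrite in_cons jt orbT.
  apply/seteqP; split=> x.
    by move=> [j]; rewrite in_cons => /orP[/eqP ->|jt] Pj; [left|right; exists j].
  case=> [Pi|[j jt Pj]]; first by exists i => //; exact: mem_head.
  by exists j => //; rewrite in_cons jt orbT.
suff H (t : seq I) : {subset t <= s} ->
    exists G, continuous G /\ forall i x, i \in t -> P i x -> G x = g i x by exact: H.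
elim: t => [|i t IH] ts; first by exists (fun=> 0); split=> // x; exact: cvg_cst.
have ts' : {subset t <= s} by move=> j jt; apply: ts; rewrite in_cons jt orbT.
have is_ : i \in s by apply: ts; exact: mem_head.
have [G [cG GE]] := IH ts'.
have [|G' [cG' GK GP]] := glue_two (clK t ts') (clP i is_) cG (cg i is_).
  by move=> x [j jt Pj] Pi; rewrite (GE j)//; apply: con => //; exact: ts'.
exists G'; split=> // j x; rewrite in_cons => /orP[/eqP ->|jt] Pj; first exact: GP.
by rewrite GK; [exact: GE|exists j].
Qed.

Lemma entry_extend (S : set X) N (f : S -> 'M[C]_N) j k : closed S ->
  contmx C S N f ->
  exists g : X -> C^o, continuous g /\
    forall x, S x -> g x = mx_entry (eval_at f x) j k.
Proof.
move=> clS cf.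
apply: (@complex_tietze S (fun x => mx_entry (eval_at f x) j k)) => //.
apply/subspace_sigL_continuousP; rewrite (_ : sigL _ _ = fun x => mx_entry (f x) j k).
  exact: mx_entry_continuous.
by apply/funext => x; rewrite /sigL /= eval_at_val.
Qed.

End ComplexTietze.

(** * The homomorphisms to the recursive algebras *)

Section Subtypes.
Variables (X : topologicalType) (S : set X).

Lemma set_val_continuous : continuous (set_val : S -> X).
Proof. exact: initial_continuous. Qed.

(** A filter on the subtype has a cluster point as soon as its image in [X] has one in
    [S]. *)
Lemma compact_set_type : compact S -> compact [set: S].
Proof.
move=> cS F FF _.
have FG : ProperFilter (set_val @ F : set_system X) by exact: fmap_proper_filter.
have [|x [Sx clx]] := cS (set_val @ F) FG.
  change (F (set_val @^-1` S)).
  by apply: (@filterS _ F _ setT) => [y _|]; [exact: set_valP|exact: filterT].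
exists (SigSub (mem_set Sx)); split=> // P U FP [_ [[W oW <-] /= Wx WU]].
have [|x' [[y Py <-] Wy]] := clx (set_val @` P) W _ (open_nbhs_nbhs (conj oW Wx)).
  change (F (set_val @^-1` (set_val @` P))).
  by apply: (@filterS _ F _ P) => // y Py; exists y.
by exists y; split=> //; exact: WU.
Qed.

Lemma hausdorff_set_type : hausdorff_space X -> hausdorff_space S.
Proof.
move=> hX p q clpq; apply: val_inj; apply: hX => U V pU qV.
have [x [Ux Vx]] := clpq _ _ (set_val_continuous pU) (set_val_continuous qV).
by exists (set_val x).
Qed.

End Subtypes.

Section Snoc.
Variables (X : topologicalType) (T : nat -> set X) (r : nat -> nat).
Variable C : numClosedFieldType.
Local Notation dsumT n := (dsum C (fun i => T i) r n).

(** The components are rebuilt from their entries, which avoids transporting [f]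
    along an equality of indices. *)
Definition dsum_snoc n (c : dsumT n) (f : T n -> 'M[C]_(r n)) : dsumT n.+1 :=
  fun i x => \matrix_(j, k) if (i < n)%N then entry c i (set_val x) j k
    else mx_entry (eval_at f (set_val x)) j k.

Lemma dsum_snocK n (c : dsumT n) f : dsum_split (dsum_snoc c f) = (c, f).
Proof.
congr pair.
  apply: functional_extensionality_dep => i; apply/funext => x.
  by apply/matrixP => j k; rewrite mxE /= ltn_ord (entry_val c x j k).
apply/funext => x; apply/matrixP => j k.
by rewrite mxE /= ltnn eval_at_val mx_entry_val.
Qed.

Lemma dsum_split_inj n : injective (@dsum_split C (fun i => T i) r n).
Proof.
move=> b b' e; apply: entryP => i x j k _ _ _.
have e1 : dsum_init b = dsum_init b' := congr1 fst e.
have e2 : b ord_max = b' ord_max := congr1 snd e.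
have [il|il] := boolP (i < n)%N; first by rewrite -!entry_init// e1.
have -> : i = ord_max by apply: val_inj => /=; have := ltn_ord i; lia.
by rewrite !entry_ord e2.
Qed.

End Snoc.

Section Gamma.
Variables (C : numClosedFieldType) (X : topologicalType) (h hinv : X -> X).
Hypotheses (hK : cancel h hinv) (hinvK : cancel hinv h).
Hypotheses (h_cont : continuous h) (hinv_cont : continuous hinv).
Variables (A : cstarAlgType C) (iota : (X -> C^o) -> A) (u : A).
Hypothesis cpA : crossed_product hinv iota u.
Variable E : A -> X -> C^o.
Hypothesis stdE : standard_expectation iota u E.
Variables (Y : set X) (m : nat) (T : nat -> set X) (r : nat -> nat).
Hypothesis rok : rokhlin_system h Y m T r.

Local Notation z := (ziter h hinv).
Local Notation AY := (orbit_breaking iota u Y).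
Local Notation gamma := (gamma h T r u E).
Local Notation orbmx := (orbmx h hinv u E).

Lemma gammaE l a (i : 'I_l.+1) (x : T i) (j k : 'I_(r i)) :
  gamma l a i x j k = orbmx a (set_val x) j k.
Proof. by rewrite mxE. Qed.

Lemma gamma_entry l a i x j k : (i <= l)%N -> T i x -> (j < r i)%N -> (k < r i)%N ->
  entry (gamma l a) i x j k = orbmx a x j k.
Proof.
move=> il Tx jr kr; have il' : (i < l.+1)%N by [].
have := @entry_val X T r C _ (gamma l a) (Ordinal il') (SigSub (mem_set Tx))
  (Ordinal jr) (Ordinal kr).
by rewrite gammaE.
Qed.

Lemma orbmx_shift a x (p : nat) (j k : int) :
  orbmx a (iter p h x) (j - p%:Z) (k - p%:Z) = orbmx a x j k.
Proof.
rewrite /orbmx -[iter p h x]/(z p x) -(ziterD hK hinvK) subrK.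
by rewrite opprB addrA subrK.
Qed.

(** A relation of [R_l] says that the window at [x] is cut into blocks at the visits of
    [nu]: inside a block this is [orbmx_shift], off the blocks it is [orbmx_block]. *)
Lemma gamma_Ralg l a : (l <= m)%N -> AY a -> Ralg h T r C l (gamma l a).
Proof.
move=> lm Aa; apply/RalgP; first exact: (r_gt0 rok (leq0n m)).
split=> [i|i nu x j k il nui hnu Tx ch jr kr].
  apply: continuous_mx => j k; rewrite (_ : (fun x => _) =
    coef u E a (j%:Z - k%:Z) \o (iter j h \o set_val)).
    move=> x; apply: continuous_comp; last exact: (sexp_cont stdE).
    apply: continuous_comp; first exact: set_val_continuous.
    exact: (@ziter_continuous X h h j h_cont h_cont).
  by apply/funext => x; rewrite gammaE.
rewrite gamma_entry//.
have Yx : Y x by apply: (T_sub_Y rok _ Tx); lia.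
move: jr kr; rewrite -hnu => {Tx hnu}.
elim: nu x j k Yx nui ch => [//|e nu IHnu] x j k Yx /= /andP[ei nui] [Te ch].
have em : (e <= m)%N by lia.
have Yr := T_return rok em Te.
rewrite /height /= -/(height r nu) => jr kr.
case: ifP => [/andP[je ke]|jke]; first by rewrite gamma_entry//; lia.
rewrite -(orbmx_shift a x (r e)); case: ifP => [/andP[je ke]|jke'].
  by rewrite -IHnu//; [rewrite -!subzn|lia|lia].
by apply: (orbmx_block hK hinvK h_cont hinv_cont cpA stdE Aa Yr); lia.
Qed.

Lemma gamma_hom l : (l <= m)%N -> star_hom AY (Ralg h T r C l) (gamma l).
Proof.
move=> lm; have Tm (i : 'I_l.+1) : (i <= m)%N by have := ltn_ord i; lia.
have win (i : 'I_l.+1) (x : T i) : Y (set_val x) /\ Y (z (r i) (set_val x)).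
  have Tx : T i (set_val x) := set_valP x.
  by split; [exact: (T_sub_Y rok (Tm i) Tx)|exact: (T_return rok (Tm i) Tx)].
have dext (b c : dsum C (fun i => T i) r l.+1) :
    (forall (i : 'I_l.+1) (x : T i) j k, b i x j k = c i x j k) -> b = c.
  move=> e; apply: functional_extensionality_dep => i; apply/funext => x.
  by apply/matrixP => j k; exact: e.
split.
- by move=> a Aa; exact: gamma_Ralg.
- apply: dext => i x j k; rewrite gammaE (orbmx1 h cpA stdE).
  by change ((j%:Z == k%:Z)%:R = (1%:M : 'M[C]_(r i)) j k); rewrite mxE.
- move=> a b _ _; apply: dext => i x j k; rewrite gammaE.
  transitivity ((gamma l a i x + gamma l b i x) j k); last by [].
  by rewrite mxE !gammaE; exact: (fcoefD stdE).
- move=> c a _; apply: dext => i x j k; rewrite gammaE.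
  transitivity ((c *: gamma l a i x) j k); last by [].
  by rewrite mxE gammaE; exact: (fcoefZ stdE).
- move=> a b Aa _; apply: dext => i x j k; rewrite gammaE.
  transitivity ((gamma l a i x *m gamma l b i x) j k); last by [].
  have [Yx Yr] := win i x; rewrite mxE.
  rewrite (orbmx_mul hK hinvK h_cont hinv_cont cpA stdE Yx Yr b j k Aa).
  by apply: eq_bigr => q _; rewrite !gammaE.
- move=> a Aa; apply: dext => i x j k; rewrite gammaE.
  transitivity ((conj_trmx (gamma l a i x)) j k); last by [].
  have [Yx Yr] := win i x; rewrite !mxE.
  by rewrite (orbmx_star hK hinvK h_cont hinv_cont cpA stdE Yx Yr j k Aa).
Qed.

(** Write a point as [h^j y] with [j] below the first return time [t] of [y].  The
    coefficient in degree [n] there is the entry [(j, j - n)] along the orbit of [y].  If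
    the column is in [0, t), this is an entry of [gamma_m]; otherwise the column is
    separated from [j] by one of the visits 0 and [t], and the entry is zero. *)
Lemma gamma_inj : hausdorff_space X -> compact Y ->
  Y `<=` closure (\bigcup_(n in [set n | (0 < n)%N]) (iter n h @` Y)) ->
  \bigcup_(n in [set: int]) (z n @` Y) = [set: X] ->
  set_inj AY (gamma m).
Proof.
move=> hX cY clY orb.
have tower := tower_cover hK hinvK h_cont rok hX cY clY orb.
have zero a n x y j : AY a -> Y y -> (j < r (base_index m T y))%N -> iter j h y = x ->
    ~~ ((0 <= j%:Z - n) && (j%:Z - n < r (base_index m T y))) -> coef u E a n x = 0.
  move=> Aa Yy jr <- jn; have [ti tT _ _] := base_indexP rok Yy.
  have [nj|nj] := ltP j%:Z n.
    exact: (coef_zero_pos hK hinvK h_cont hinv_cont cpA stdE Aa Yy nj).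
  apply: (@coef_zero_neg _ _ _ _ hK hinvK h_cont hinv_cont _ _ _ cpA _ stdE Y
    a n (r (base_index m T y) - j)%N) => //; [|by lia|by lia].
  rewrite /= -iterD subnK; last by lia.
  exact: (T_return rok ti tT).
have band a n x : AY a -> (r m)%:Z <= `|n| -> coef u E a n x = 0.
  move=> Aa rn; have [y [j [Yy jr jx]]] := tower x.
  have [ti tT _ _] := base_indexP rok Yy; have := r_mono rok ti (leqnn m).
  by move=> rr; apply: (zero a n x y j) => //; lia.
move=> a a' /set_mem Aa /set_mem Aa' eaa'.
apply/eqP; rewrite -subr_eq0; apply/eqP.
rewrite (orbit_breaking_fourier hK hinvK h_cont hinv_cont cpA stdE band (orbit_breakingB Aa Aa')).
apply: big1 => q _; rewrite (_ : coef _ _ _ _ = 0) ?(iota0 cpA) ?amul0l//.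
apply/funext => x; set n := q%:Z - _; have [y [j [Yy jr jx]]] := tower x.
have [ti tT _ _] := base_indexP rok Yy.
have [/andP[k0 kr]|jn] := boolP ((0 <= j%:Z - n) && (j%:Z - n < r (base_index m T y))); last first.
  exact: (zero (a - a') n x y j (orbit_breakingB Aa Aa')).
rewrite (fcoefB stdE); have kr' : (`|j%:Z - n| < r (base_index m T y))%N by lia.
have ek b : coef u E b n x = orbmx b y j `|j%:Z - n|%N.
  rewrite /orbmx -jx; congr (coef u E b _ _); lia.
by rewrite !ek -!(gamma_entry (l := m) _ ti tT jr kr') eaa' subrr.
Qed.

End Gamma.

(** * Surjectivity *)

(** The times [p] such that [a_n x] must vanish when [h^p x] is in [Y]: those at
    which a visit separates the row index from the column index. *)
Definition zero_shifts (n : int) : seq int :=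
  if n is Posz q then [seq - p%:Z | p <- iota 0 q]
  else [seq p%:Z | p <- iota 1 `|n|].

Lemma mem_zero_shifts n p : (p \in zero_shifts n) =
  (- n < p) && (p <= 0) || (0 < p) && (p <= - n).
Proof.
case: n => q; apply/mapP/idP.
- by case=> i; rewrite mem_iota => iq ->; lia.
- by move=> pq; exists `|p|%N; [rewrite mem_iota|]; lia.
- by case=> i; rewrite mem_iota => iq ->; lia.
- by move=> pq; exists `|p|%N; [rewrite mem_iota|]; lia.
Qed.

Section Surjectivity.
Variables (R : realType) (X : topologicalType).
Hypotheses (X_hausdorff : hausdorff_space X) (X_compact : compact [set: X]).
Local Notation C := (R[i]).
Variables (h hinv : X -> X).
Hypotheses (hK : cancel h hinv) (hinvK : cancel hinv h).
Hypotheses (h_cont : continuous h) (hinv_cont : continuous hinv).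
Variables (Y : set X) (m : nat) (T : nat -> set X) (r : nat -> nat).
Hypothesis Y_compact : compact Y.
Hypothesis rok : rokhlin_system h Y m T r.

Local Notation z := (ziter h hinv).

Let X_normal : normal_space X := compact_normal X_hausdorff X_compact.

Let Y_closed : closed Y.
Proof. exact: compact_closed. Qed.

Lemma T_closed i : (i <= m)%N -> closed (T i).
Proof. by move=> im; apply: compact_closed => //; exact: (rok_compact rok). Qed.

Section Coefficient.
Variables (l : nat) (b : dsum C (fun i => T i) r l.+1).
Hypotheses (lm : (l <= m)%N) (Rb : Ralg h T r C l b).

(** Each entry of [b] is extended from [T_i] to [X] first, so that only globally
    defined functions have to be glued. *)
Lemma entry_extension : exists g : nat -> nat -> nat -> X -> C^o,
  forall i j k, (i <= l)%N -> continuous (g i j k) /\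
    forall x, T i x -> g i j k x = entry b i x j k.
Proof.
have [cb _] := (RalgP h b (r_gt0 rok (leq0n m))).1 Rb.
have ex (t : nat * nat * nat) : exists g : X -> C^o, (t.1.1 <= l)%N ->
    continuous g /\ forall x, T t.1.1 x -> g x = entry b t.1.1 x t.1.2 t.2.
  case: t => [[i j] k] /=; have [il|il] := boolP (i <= l)%N; last by exists 0.
  have il' : (i < l.+1)%N by [].
  have [|g [cg gE]] := entry_extend X_normal X_compact j k _ (cb (Ordinal il')).
    by apply: T_closed => /=; lia.
  exists g => _; split=> // x Tx; rewrite gE//.
  by rewrite -(entry_ord b (Ordinal il')).
have [g gP] := choice ex.
exists (fun i j k => g (i, j, k)) => i j k il.
exact: (gP (i, j, k)).
Qed.

(** If the row of one entry is the point [h^j x = h^j' x'] with [j <= j'], then [x] is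
    a visit of the orbit of [x'], and canonical entries are invariant under moving the
    base point to a visit. *)
Lemma Ralg_consistent i i' (j j' k k' : nat) x x' : (i <= l)%N -> (i' <= l)%N ->
  T i x -> T i' x' -> iter j h x = iter j' h x' -> j%:Z - k%:Z = j'%:Z - k'%:Z ->
  (j < r i)%N -> (k < r i)%N -> (j' < r i')%N -> (k' < r i')%N ->
  entry b i x j k = entry b i' x' j' k'.
Proof.
wlog jj : i i' j j' k k' x x' / (j <= j')%N.
  move=> H il il' Tx Tx' e ejk jr kr jr' kr'.
  have [jj|jj] := leqP j j'; first exact: H.
  by apply/esym; apply: H => //; lia.
move=> il il' Tx Tx' e ejk jr kr jr' kr'.
have Yx : Y x by apply: (T_sub_Y rok _ Tx); lia.
have Yx' : Y x' by apply: (T_sub_Y rok _ Tx'); lia.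
have ex : x = iter (j' - j) h x'.
  have := congr1 (iter j hinv) e.
  by rewrite !(iter_cancel _ hK)// subnn.
rewrite (Ralg_canonical rok lm Rb il Tx jr kr) (Ralg_canonical rok lm Rb il' Tx' jr' kr').
rewrite (@canonical_entry_shift _ h Y m T C _ x' (j' - j))// -?ex//; try lia.
by congr canonical_entry; lia.
Qed.

(** The function [a_n] is prescribed on finitely many closed sets: on [h^j (T_i)] by the
    entries [(j, j - n)] of [b], and by zero on the translates of [Y] in [zero_shifts].
    The prescriptions agree by [Ralg_consistent] and [canonical_entry_cut]. *)
Lemma coefficient_function (n : int) : exists G : X -> C^o,
  [/\ continuous G,
    forall i (j k : nat) x, (i <= l)%N -> T i x -> (j < r i)%N -> (k < r i)%N ->
      j%:Z - k%:Z = n -> G (iter j h x) = entry b i x j k &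
    forall p x, p \in zero_shifts n -> Y (z p x) -> G x = 0].
Proof.
have [g gP] := entry_extension.
(* The row [j] of [T_i] matters if the column [j - n] is in its window. *)
pose good (t : nat * nat) := (t.1 <= l)%N && (t.2 < r t.1)%N &&
  (0 <= t.2%:Z - n) && (t.2%:Z - n < r t.1).
pose P (t : nat * nat + int) : set X := match t with
  | inl ij => z (- ij.2%:Z) @^-1` T ij.1 | inr p => z p @^-1` Y end.
pose F (t : nat * nat + int) : X -> C^o := match t with
  | inl ij => g ij.1 ij.2 `|ij.2%:Z - n|%N \o z (- ij.2%:Z) | inr p => 0 end.
pose pairs := [seq t <- [seq (i, j) | i <- iota 0 l.+1, j <- iota 0 (r i)] | good t].
have mem_pairs t : t \in pairs = good t.
  rewrite mem_filter andb_idr// => /andP[/andP[/andP[tl tr] _] _].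
  case: t tl tr => i j; rewrite [(i, j).1]/= [(i, j).2]/= => il jr.
  by apply/allpairsPdep; exists i, j; rewrite !mem_iota; split=> //; lia.
pose s := map inl pairs ++ map inr (zero_shifts n) : seq (nat * nat + int).
have inl_s t : (inl t \in s) = good t.
  rewrite mem_cat orbC; case: mapP => [[? _ //]|_].
  by rewrite (mem_map (inl_inj)) mem_pairs.
have inr_s p : (inr p \in s) = (p \in zero_shifts n).
  rewrite mem_cat; case: mapP => [[? _ //]|_].
  by rewrite (mem_map (inr_inj)).
have cz p : continuous (z p) by exact: ziter_continuous.
have FE i j x : good (i, j) -> T i (z (- j%:Z) x) ->
    F (inl (i, j)) x = entry b i (z (- j%:Z) x) j `|j%:Z - n|%N.
  by move=> /andP[/andP[/andP[/= il _] _] _] Tx; rewrite /F /= (gP i j _ il).2.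
have [t|t|t t' x|G [cG GE]] := @glue_finite R X X_normal X_compact _ s P F.
- case: t => [t|p].
    rewrite inl_s => /andP[/andP[/andP[tl _] _] _].
    by apply: (continuous_closedP _).1 => //; apply: T_closed; lia.
  by move=> _; apply: (continuous_closedP _).1.
- case: t => [t|p]; last by move=> _ x; exact: cvg_cst.
  rewrite inl_s => /andP[/andP[/andP[tl _] _] _] x.
  apply: continuous_comp; first exact: cz.
  exact: (gP _ _ _ tl).1.
- have cut i j p : good (i, j) -> T i (z (- j%:Z) x) ->
      p \in zero_shifts n -> Y (z p x) -> F (inl (i, j)) x = 0.
    move=> gij Tx; rewrite mem_zero_shifts => np Yp; rewrite FE//.
    move: (gij) => /andP[/andP[/andP[/= il jr] n0] nr].
    have im : (i <= m)%N by lia.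
    rewrite (Ralg_canonical rok lm Rb il Tx jr); last by lia.
    have jp0 : 0 <= j%:Z + p by lia.
    have [q eq] : exists q : nat, q%:Z = j%:Z + p by exists `|(j%:Z + p)%R|%N; lia.
    apply: (@canonical_entry_cut _ h Y m T _ _ _ q); last by lia.
    rewrite -[iter _ h _]/(z q _) -(ziterD hK hinvK).
    by rewrite eq addrAC subrr add0r.
  case: t t' => [[i j]|p] [[i' j']|p'].
  + rewrite !inl_s => gij gij' Tx Tx'; rewrite !FE//.
    move: gij gij' => /andP[/andP[/andP[/= il jr] n0] nr].
    move=> /andP[/andP[/andP[/= il' jr'] n0'] nr'].
    apply: Ralg_consistent => //; try lia.
    rewrite -[iter j h _]/(z j _) -[iter j' h _]/(z j' _) -!(ziterD hK hinvK).
    by rewrite !addrN.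
  + rewrite inl_s inr_s => gij p's Tx Yp; exact: (cut i j p').
  + rewrite inl_s inr_s => ps gij Yp Tx; apply/esym; exact: (cut i' j' p).
  + by [].
exists G; split=> //.
- move=> i j k x il Tx jr kr ejk.
  have gij : good (i, j) by rewrite /good /= il jr /=; lia.
  have zx : z (- j%:Z) (iter j h x) = x.
    by rewrite -[iter j h x]/(z j x) -(ziterD hK hinvK) addNr.
  rewrite (GE (inl (i, j))) ?inl_s//; last by rewrite /P /= zx.
  by rewrite FE// zx//; congr entry; lia.
- by move=> p x ps Yp; rewrite (GE (inr p)) ?inr_s.
Qed.

End Coefficient.

Section CrossedProductSurjectivity.
Variables (A : cstarAlgType C) (iota : (X -> C^o) -> A) (u : A).
Hypothesis cpA : crossed_product hinv iota u.
Variable E : A -> X -> C^o.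
Hypothesis stdE : standard_expectation iota u E.
Local Notation AY := (orbit_breaking iota u Y).

Lemma coef_sum I (s : seq I) (P : pred I) (F : I -> A) n x :
  coef u E (\sum_(i <- s | P i) F i) n x = \sum_(i <- s | P i) (coef u E (F i) n x : C).
Proof.
elim/big_rec2: _ => [|i y a _ <-]; first exact: (fcoef0 stdE).
exact: (fcoefD stdE).
Qed.

(** The preimage is the trigonometric polynomial with the coefficients of
    [coefficient_function]; their zeros put each of its terms in the subalgebra.  Degrees
    beyond [r_l] do not occur in the windows. *)
Lemma gamma_surj l : (l <= m)%N ->
  set_surj AY (Ralg h T r C l) (gamma h T r u E l).
Proof.
move=> lm b Rb; have [G GP] := choice (coefficient_function lm Rb).
have cG n : contfun C X (G n) by have [] := GP n.
pose N := r l.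
pose a := \sum_(q < N.*2.+1) iota (G (q%:Z - N%:Z)) ** upow u (q%:Z - N%:Z).
have AYG n : AY (iota (G n) ** upow u n).
  have [_ _ G0] := GP n; have [n0|n0] := leP 0 n.
    have en : n = `|n|%N by lia.
    rewrite [X in upow u X]en.
    apply: (orbit_breaking_monomial hinvK h_cont cpA (cG _)) => y i Yy ni.
    apply: (G0 (- i%:Z)) => //; first by rewrite mem_zero_shifts; lia.
    by rewrite -(ziterD hK hinvK) addNr.
  have en : n = - `|n|%N%:Z by lia.
  rewrite [X in upow u X]en.
  apply: (orbit_breaking_monomialN hK hinvK h_cont hinv_cont cpA (cG _)) => x i Yi ni.
  by apply: (G0 i) => //; rewrite mem_zero_shifts; lia.
have coefa (n : int) x : `|n| <= N%:Z -> coef u E a n x = G n x.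
  move=> nN; rewrite coef_sum.
  (* Degree [n] is the term of index [n + N] of the window from [-N] to [N]. *)
  have qN : (`|(n + N%:Z)%R| < N.*2.+1)%N by lia.
  rewrite (bigD1 (Ordinal qN))//= big1 ?addr0 => [|q /eqP qn].
    by rewrite (coef_mono cpA stdE)// (_ : _ - _ = n) ?eqxx//; lia.
  rewrite (coef_mono cpA stdE)// ifF//; apply/negP => /eqP e; apply: qn.
  by apply: val_inj => /=; lia.
exists a; first exact: orbit_breaking_sum.
apply: entryP => i x j k Tx jr kr; have il : (i <= l)%N by have := ltn_ord i.
have rr := r_mono rok il lm.
rewrite (gamma_entry h hinv)// /orbmx coefa; last by lia.
by have [_ GE _] := GP (j%:Z - k%:Z); exact: GE.
Qed.

End CrossedProductSurjectivity.
End Surjectivity.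

(** * The attaching maps and the recursive decomposition *)

Section Attaching.
Variables (R : realType) (X : topologicalType).
Hypotheses (X_hausdorff : hausdorff_space X) (X_compact : compact [set: X]).
Local Notation C := (R[i]).
Variables (h hinv : X -> X).
Hypotheses (hK : cancel h hinv) (hinvK : cancel hinv h).
Hypotheses (h_cont : continuous h) (hinv_cont : continuous hinv).
Variables (Y : set X) (m : nat) (T : nat -> set X) (r : nat -> nat).
Hypothesis Y_compact : compact Y.
Hypothesis rok : rokhlin_system h Y m T r.
Variables (A : cstarAlgType C) (iota : (X -> C^o) -> A) (u : A).
Hypothesis cpA : crossed_product hinv iota u.
Variable E : A -> X -> C^o.
Hypothesis stdE : standard_expectation iota u E.

Local Notation AY := (orbit_breaking iota u Y).
Local Notation gamma := (gamma h T r u E).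
Local Notation Ralg := (Ralg h T r C).
Local Notation dsumT n := (dsum C (fun i => T i) r n).

Let gRalg l a : (l <= m)%N -> AY a -> Ralg l (gamma l a).
Proof.
by move=> lm; exact: (gamma_Ralg hK hinvK h_cont hinv_cont cpA stdE rok lm).
Qed.

Let ghom l : (l <= m)%N -> star_hom AY (Ralg l) (gamma l).
Proof. by move=> lm; exact: (gamma_hom hK hinvK h_cont hinv_cont cpA stdE rok lm). Qed.

Let gsurj l : (l <= m)%N -> set_surj AY (Ralg l) (gamma l).
Proof.
by move=> lm; exact: (gamma_surj X_hausdorff X_compact hK hinvK h_cont hinv_cont
  Y_compact rok cpA stdE lm).
Qed.

(** The map [beta_(l+1)], through a lift of [b] to the orbit-breaking algebra. *)
Definition attach l (b : dsumT l.+1) : Dset T l.+1 -> 'M[C]_(r l.+1) :=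
  if pselect (exists a, AY a /\ gamma l a = b) is left e
  then gamma l.+1 (projT1 (cid e)) ord_max \o set_val else 0.
Arguments attach : clear implicits.

Lemma Dset_cover l (y : Dset T l.+1) : (l < m)%N ->
  exists mu : seq 'I_l.+1, admissible r mu /\ Tmu h r mu (set_val y).
Proof.
move=> lm; have [Tx [j jl Tj]] : (T l.+1 `&` Tprev T l.+1) (set_val (set_val y)).
  exact: (set_valP y).
have jm : (j <= m)%N by move: jl => /=; lia.
have [_ _ tmin _] := base_indexP rok (T_sub_Y rok lm Tx).
have [|nu [nul hnu ch]] := overlap_chain rok lm Tx.
  by apply: leq_ltn_trans (tmin j Tj jm) _.
have [mu emu] := ordseq_lift nul; exists mu; split.
  by rewrite /admissible /= -(height_val r) emu.
by apply/TmuP; rewrite emu.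
Qed.

Lemma gamma_beta l a (mu : seq 'I_l.+1) (x : Tmu h r mu) : (l < m)%N ->
  AY a -> admissible r mu ->
  gamma l.+1 a ord_max (set_val x) = beta_mu (gamma l a) x.
Proof. by move=> lm Aa adm; have [_ _ rel] := gRalg lm Aa; exact: rel. Qed.

(** Two lifts of the same [b] have the same values on [D_(l+1)], because these are
    given by the [beta_(l+1, mu)] of [b]. *)
Lemma attachE l a y : (l < m)%N -> AY a ->
  attach l (gamma l a) y = gamma l.+1 a ord_max (set_val y).
Proof.
move=> lm Aa; rewrite /attach; case: pselect => [e|[]]; last by exists a.
case: (cid e) => a' [Aa' ea'] /=.
have [mu [adm Ty]] := Dset_cover y lm.
pose x : Tmu h r mu := SigSub (mem_set Ty).
have gb c (Ac : AY c) := gamma_beta (a := c) x lm Ac adm.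
exact: etrans (gb a' Aa') (etrans (congr1 (fun c => beta_mu c x) ea') (esym (gb a Aa))).
Qed.

Lemma attach_beta l b (mu : seq 'I_l.+1) (x : Tmu h r mu) (y : Dset T l.+1) :
  (l < m)%N -> Ralg l b -> admissible r mu -> set_val y = set_val x ->
  attach l b y = beta_mu b x.
Proof.
move=> lm Rb adm exy; have [a Aa <-] := gsurj (ltnW lm) Rb.
by rewrite attachE// exy gamma_beta.
Qed.

(** All properties are inherited from [gamma_l] and [gamma_(l+1)], since every element of
    [R_l] has a lift. *)
Lemma attach_hom l : (l < m)%N ->
  star_hom (Ralg l) (contmx C (Dset T l.+1) (r l.+1)) (attach l).
Proof.
move=> lm; have lm' := ltnW lm; have g := ghom lm'; have g1 := ghom lm.
split.
- move=> _ /(gsurj lm') [a Aa <-].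
  have [_ cg _] := gRalg lm Aa.
  rewrite (_ : attach l _ = gamma l.+1 a ord_max \o set_val); last first.
    by apply/funext => y; rewrite attachE.
  by move=> y; apply: continuous_comp; [exact: set_val_continuous|exact: cg].
- rewrite -(star_hom1 g); apply/funext => y.
  by rewrite attachE ?(star_hom1 g1)//; exact (@orbit_breaking1 _ _ _ _ _ _ cpA Y).
- move=> _ _ /(gsurj lm') [a Aa <-] /(gsurj lm') [b Ab <-].
  rewrite -(star_homD g)//; apply/funext => y.
  rewrite attachE//; last exact (csubD (orbit_breaking_subalgebra iota u Y) Aa Ab).
  by rewrite (star_homD g1)// -[RHS]/(attach l _ y + attach l _ y) !attachE.
- move=> k _ /(gsurj lm') [a Aa <-].
  rewrite -(star_homZ g)//; apply/funext => y.
  rewrite attachE//; last exact (csubZ (orbit_breaking_subalgebra iota u Y) k Aa).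
  by rewrite (star_homZ g1)// -[RHS]/(k *: attach l _ y) !attachE.
- move=> _ _ /(gsurj lm') [a Aa <-] /(gsurj lm') [b Ab <-].
  rewrite -(star_homM g)//; apply/funext => y.
  rewrite attachE//; last exact (csubM (orbit_breaking_subalgebra iota u Y) Aa Ab).
  by rewrite (star_homM g1)// -[RHS]/(attach l _ y ** attach l _ y) !attachE.
- move=> _ /(gsurj lm') [a Aa <-].
  rewrite -(star_hom_star g)//; apply/funext => y.
  rewrite attachE//; last exact (csub_star (orbit_breaking_subalgebra iota u Y) Aa).
  by rewrite (star_hom_star g1)// -[RHS]/(star (attach l _ y)) !attachE.
Qed.

Lemma attach_is_beta l : (l < m)%N -> is_beta h (attach l).
Proof.
move=> lm; split.
  split; first exact: attach_hom.
  by move=> b Rb mu adm x y; exact: attach_beta.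
move=> beta' [_ beta'E] b Rb; apply/funext => y.
have [mu [adm Ty]] := Dset_cover y lm.
pose x : Tmu h r mu := SigSub (mem_set Ty).
by rewrite (beta'E b Rb mu adm x)// (attach_beta (x := x)).
Qed.

(** As the [T_(l+1, mu)] lie in [D_(l+1)] and cover it, the relations for all [mu] amount
    to one equation on [D_(l+1)]. *)
Lemma RalgS l (b : dsumT l.+2) : (l < m)%N ->
  Ralg l.+1 b <-> pullback (Ralg l) (contmx C (T l.+1) (r l.+1)) (attach l)
    (fun f => f \o set_val) (dsum_split b).
Proof.
move=> lm; split=> [[Rb cb rel]|[Rb cb eb]].
  split=> //; apply/funext => y.
  have [mu [adm Ty]] := Dset_cover y lm.
  pose x : Tmu h r mu := SigSub (mem_set Ty).
  by rewrite (attach_beta (x := x))//= -(rel mu adm x).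
split=> // mu adm x.
have r0 := r_gt0 rok lm.
have Dx : (set_val @^-1` (T l.+1 `&` Tprev T l.+1)) (set_val x : T l.+1).
  split; first exact: (set_valP (set_val x)).
  case: mu adm x => [|i mu] adm x.
    by move: r0; rewrite -adm big_nil.
  have /TmuP [Ti _] : Tmu h r (i :: mu) (set_val x) := set_valP x.
  by exists i => //; exact: ltn_ord.
pose y : Dset T l.+1 := SigSub (mem_set Dx).
by rewrite -(attach_beta (y := y))// -[LHS]/((b ord_max \o set_val) y) -eb.
Qed.

Lemma attach_rsh : @rsh_decomposition C m (fun l => T l) (Dset T) r Ralg attach.
Proof.
split.
- move=> l lm; split.
    by apply: compact_set_type; exact: (rok_compact rok).
  exact: hausdorff_set_type.
- by move=> l lm; exact: (r_gt0 rok).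
- move=> l lm; apply: (continuous_closedP _).1; first exact: set_val_continuous.
  apply: closedI; first exact: (T_closed X_hausdorff rok lm).
  apply: closed_bigcup => [|j /= jl]; first exact: finite_II.
  by apply: (T_closed X_hausdorff rok); lia.
- split; first by split.
  split=> // [b b' _ _ e|f cf].
    by apply: functional_extensionality_dep => i; rewrite (ord1 i).
  pose b0 : dsumT 1 := fun i x =>
    \matrix_(j, k) mx_entry (eval_at (f : T 0 -> 'M[C]_(r 0)) (set_val x)) j k.
  have eb0 : b0 ord0 = f.
    apply/funext => x; apply/matrixP => j k.
    by rewrite mxE eval_at_val mx_entry_val.
  refine (ex_intro2 _ _ b0 _ eb0).
  change (contmx C (T 0) (r 0) (b0 ord0)); rewrite eb0; exact: cf.
- exact: attach_hom.
- move=> l lm; split; first by split=> // b /(RalgS _ lm).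
  split; first by move=> b /(RalgS _ lm).
    by move=> b b' _ _; exact: dsum_split_inj.
  move=> [c f] pcf; exists (dsum_snoc c f); last exact: dsum_snocK.
  by apply/(RalgS _ lm); rewrite dsum_snocK.
Qed.

End Attaching.

Local Open Scope complex_scope.
Unset Implicit Arguments.

Theorem theorem2p22 (R : realType) (X : metricType R)
  (X_compact : compact [set: X])
  (h hinv : X -> X)
  (hK : cancel h hinv) (hinvK : cancel hinv h)
  (h_cont : continuous h) (hinv_cont : continuous hinv)
  (Y : set X) (Y_nonempty : Y !=set0) (Y_compact : compact Y)
  (Y_closure :
    Y `<=` closure (\bigcup_(n in [set n | (0 < n)%N]) (iter n h @` Y)))
  (m : nat) (T : nat -> set X) (r : nat -> nat)
  (T_rokhlin : rokhlin_system h Y m T r)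
  (A : cstarAlgType R[i]) (iota : (X -> R[i]^o) -> A) (u : A)
  (A_crossed : crossed_product hinv iota u)
  (E : A -> X -> R[i]^o) (E_standard : standard_expectation iota u E) :
  (exists beta : forall l, dsum R[i] (fun i => T i) r l.+1 ->
      Dset T l.+1 -> 'M[R[i]]_(r l.+1),
    (forall l, (l < m)%N -> is_beta h (beta l)) /\
    @rsh_decomposition R[i] m (fun l => T l) (Dset T) r (Ralg h T r R[i]) beta)
  /\
  (star_hom (orbit_breaking iota u Y) (Ralg h T r R[i] m)
     (gamma h T r u E m) /\
   set_surj (orbit_breaking iota u Y) (Ralg h T r R[i] m)
     (gamma h T r u E m))
  /\
  (\bigcup_(n in [set: int]) (ziter h hinv n @` Y) = [set: X] ->
   star_iso (orbit_breaking iota u Y) (Ralg h T r R[i] m)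
     (gamma h T r u E m)).
Proof.
have X_hausdorff := @metric_hausdorff R X.
have hom := gamma_hom hK hinvK h_cont hinv_cont A_crossed E_standard T_rokhlin
  (leqnn m).
have surj := gamma_surj X_hausdorff X_compact hK hinvK h_cont hinv_cont Y_compact
  T_rokhlin A_crossed E_standard (leqnn m).
split; last split=> //.
  exists (fun l => attach h Y iota u E (l := l)); split.
    move=> l lm; exact: (attach_is_beta X_hausdorff X_compact hK hinvK h_cont
      hinv_cont Y_compact T_rokhlin A_crossed E_standard lm).
  exact: (attach_rsh X_hausdorff X_compact hK hinvK h_cont hinv_cont Y_compact
    T_rokhlin A_crossed E_standard).
move=> orb; split=> //; split=> //; first exact: star_hom_sub hom.
exact: (gamma_inj hK hinvK h_cont hinv_cont A_crossed E_standard T_rokhlin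
  X_hausdorff Y_compact Y_closure orb).
Qed.
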